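(* Let $\sigma$ be an $(\alpha,\beta)$-ReLU activation, and consider the covariance sequence $\{\Sigma^{(L)}\}$ and metrics $\mathrm{FSP}_L(\sigma_w^2)$, $\mathrm{GEV}_L(\sigma_w^2)$ defined in the context. Then: 1. If $\sigma_w^2=2/(\alpha^2+\beta^2)$, then either $\lim_{L\to\infty}\mathrm{GEV}_L(\sigma_w^2)=0$ or $\lim_{L\to\infty}\mathrm{FSP}_L(\sigma_w^2)=0$. 2. If $0<\sigma_w^2<2/(\alpha^2+\beta^2)$, then for every $L\ge1$, $\mathrm{FSP}_L(\sigma_w^2)\le\frac{2C}{(\alpha^2+\beta^2)d_0}\left(\frac{\sigma_w^2(\alpha^2+\beta^2)}{2}\right)^L.$
   Context: An activation $\sigma:\mathbb R\to\mathbb R$ is $(\alpha,\beta)$-ReLU if $\sigma(x)=\alpha x$ for $x\ge0$ and $\sigma(x)=\beta x$ for $x<0$, where $\alpha,\beta\ge0$ are not both $0$. Let $\mathcal G=(\mathcal V,\mathcal E)$ be a finite undirected graph with $n$ nodes, adjacency matrix $A$, degree matrix $D=\mathrm{diag}(A\mathbf 1_n)$ with degrees $d_i$, $\tilde A=A+I$, $\tilde D=D+I$, $\hat A=\tilde D^{-1/2}\tilde A\tilde D^{-1/2}$, $\hat L=I-\hat A$. For $H\in\mathbb R^{n\times C}$ with rows $h_i$, $\mathrm{Dir}(H)=\mathrm{tr}(H^\top\hat LH)=\sum_{\{i,j\}\in\mathcal E}\|h_i/\sqrt{1+d_i}-h_j/\sqrt{1+d_j}\|^2$. Let $X\in\mathbb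 R^{n\times d_0}$ be nonzero, $C\ge1$ an integer, $\sigma_w^2>0$. For positive semidefinite $\Sigma$ put $G(\Sigma)=\mathbb E_{h\sim N(\mathbf 0_n,\Sigma)}[\sigma(h)\sigma(h)^\top]$ (entrywise $\sigma$). Define $\Sigma^{(1)}=\frac{\sigma_w^2}{d_0}\hat AXX^\top\hat A$, $\Sigma^{(l+1)}=\sigma_w^2\hat AG(\Sigma^{(l)})\hat A$. With $H\in\mathbb R^{n\times C}$ having i.i.d. columns $N(\mathbf 0_n,\Sigma^{(L)})$: $\mathrm{FSP}_L(\sigma_w^2)=\mathbb E[\|H\|_F^2/\|X\|_F^2]$, $\mathrm{GEV}_L(\sigma_w^2)=\mathbb E[\mathrm{Dir}(H)/\|H\|_F^2]$. *)

(* Defs.v *)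
From HB Require Import structures.
From mathcomp Require Import all_boot all_order all_algebra.
From mathcomp Require Import all_classical all_reals all_analysis.
Set Implicit Arguments. Unset Strict Implicit. Unset Printing Implicit Defensive.
Import Order.TTheory GRing.Theory Num.Theory.
Local Open Scope classical_set_scope.
Local Open Scope ring_scope.

Section GCNDefs.
Variable R : realType.

Definition abrelu (alpha beta : R) (x : R) : R :=
  if 0 <= x then alpha * x else beta * x.

(* Graph on n nodes given by a symmetric irreflexive relation e.          *)
Definition adjmx n (e : rel 'I_n) : 'M[R]_n := \matrix_(i, j) (e i j)%:R.
Definition deg n (e : rel 'I_n) (i : 'I_n) : R := \sum_j adjmx e i j.
Definition Dtinvsqrt n (e : rel 'I_n) : 'M[R]_n :=
  \matrix_(i, j) (if i == j then (Num.sqrt (1 + deg e i))^-1 else 0).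
Definition Ahat n (e : rel 'I_n) : 'M[R]_n :=
  Dtinvsqrt e *m (adjmx e + 1%:M) *m Dtinvsqrt e.
Definition Lhat n (e : rel 'I_n) : 'M[R]_n := 1%:M - Ahat e.

Definition Dir n C (e : rel 'I_n) (H : 'M[R]_(n, C)) : R :=
  \tr (H^T *m Lhat e *m H).
Definition frob2 m k (H : 'M[R]_(m, k)) : R := \sum_i \sum_j H i j ^+ 2.

(* Expectation over k i.i.d. standard normal variables z 0, ..., z (k-1)
   (iterated integral w.r.t. the product of standard normal laws).        *)
Fixpoint stdGaussE (k : nat) (f : (nat -> R) -> \bar R) : \bar R :=
  match k with
  | 0 => f (fun _ => 0)
  | k'.+1 => (\int[normal_prob 0 1]_x
                stdGaussE k' (fun v => f (fun i => if i == k' then x else v i)))%E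
  end.

(* a matrix square root factor B with B B^T = S (chosen; any choice gives
   the same Gaussian law N(0, S) for B z, z standard) *)
Definition covfactor n (S : 'M[R]_n) : 'M[R]_n :=
  xget 0 [set B : 'M[R]_n | B *m B^T = S].

Definition zmat n C (z : nat -> R) : 'M[R]_(n, C) :=
  \matrix_(i < n, j < C) z (i + n * j)%N.

(* E[ f(H) ] for H in R^{n x C} with i.i.d. columns N(0, S) *)
Definition gaussMxE n C (S : 'M[R]_n) (f : 'M[R]_(n, C) -> \bar R) : \bar R :=
  stdGaussE (n * C) (fun z => f (covfactor S *m zmat n C z)).

Definition Gmx (sigma : R -> R) n (S : 'M[R]_n) : 'M[R]_n :=
  \matrix_(i, j) fine (@gaussMxE n 1 S (fun h => (sigma (h i 0) * sigma (h j 0))%:E)).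

(* Sigma^(L) for L >= 1 (Sigma_seq L = Sigma^(L); the value at L = 0 is
   not used and is set equal to Sigma^(1)). *)
Definition Sigma1 n d0 (e : rel 'I_n) (sw2 : R) (X : 'M[R]_(n, d0)) : 'M[R]_n :=
  (sw2 / d0%:R) *: (Ahat e *m X *m X^T *m Ahat e).
Definition Sigma_seq (sigma : R -> R) n d0 (e : rel 'I_n) (sw2 : R)
    (X : 'M[R]_(n, d0)) (L : nat) : 'M[R]_n :=
  iter L.-1 (fun S => sw2 *: (Ahat e *m Gmx sigma S *m Ahat e)) (Sigma1 e sw2 X).

Definition FSP (sigma : R -> R) n d0 C (e : rel 'I_n) (X : 'M[R]_(n, d0))
    (sw2 : R) (L : nat) : \bar R :=
  @gaussMxE n C (Sigma_seq sigma e sw2 X L) (fun H => (frob2 H / frob2 X)%:E).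
Definition GEV (sigma : R -> R) n d0 C (e : rel 'I_n) (X : 'M[R]_(n, d0))
    (sw2 : R) (L : nat) : \bar R :=
  @gaussMxE n C (Sigma_seq sigma e sw2 X L) (fun H => (Dir e H / frob2 H)%:E).

End GCNDefs.

(* Main.v *)
(** Writing [c = (alpha^2 + beta^2) / 2], the symmetry [h -> - h] of a centred
    Gaussian vector gives [E (sigma h_i)^2 = c * S i i], so [tr G(S) = c * tr S];
    as [Ahat^2 <= I], the trace of the covariance is multiplied by at most
    [sw2 * c] at each layer, which yields the geometric bound for [FSP].
    In the critical case [sw2 * c = 1] the traces [t_m] decrease to some limit
    [l].  If [l = 0] then [FSP] tends to 0.  Otherwise the self-loops keep the
    spectrum of [Ahat] away from -1, so that
    [Ahat (I - Ahat) Ahat <= (n + 1) (I - Ahat^2)]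
    and the mean Dirichlet energy is at most a constant times [t_m - t_(m+1)],
    which tends to 0; Gaussian anti-concentration of one entry, whose variance is
    bounded below in terms of [l], transfers this to the ratio [Dir H / |H|^2]. *)
Require Import Defs.
From HB Require Import structures.
From mathcomp Require Import all_boot all_order all_algebra.
From mathcomp Require Import all_classical all_reals all_analysis.
From mathcomp Require Import measurable_realfun normal_distribution.
From mathcomp Require Import ring lra.
Set Implicit Arguments. Unset Strict Implicit. Unset Printing Implicit Defensive.
Import Order.TTheory GRing.Theory Num.Theory.
Import numFieldNormedType.Exports.
Local Open Scope classical_set_scope.
Local Open Scope ring_scope.

(** * The standard normal law *)

Section std_normal.
Context {R : realType}.
Local Notation mu := (@lebesgue_measure R).
Local Notation gauss := (@normal_prob R 0 1).
Local Notation phi := (@normal_pdf R 0 1).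
Local Open Scope ereal_scope.

(** [stdGaussE] is a nest of one-dimensional integrals, from which not even linearity can be read
    off. It is therefore represented as a single integral over a product space, for measurable
    integrands of at most quadratic growth. From then on independence enters only through resampling
    one coordinate of a nonnegative integrand: this gives the sign symmetry, the covariances (by
    polarization) and the small-ball bound. The other obstacle is the quotient in [GEV]: a vanishing
    mean energy says nothing about the mean of [Dir H / |H|^2] unless [H] is rarely small, and the
    law of [H] may be degenerate. One entry of the covariance factor of size at least
    [sqrt l / (n + 1)] suffices to bound the probability of [|H| < s] by a multiple of [s]. The
    cut-off [s] has to shrink with the layer, but more slowly than the square root of the mean
    energy. The spectral inequalities for [Ahat] are obtained without diagonalization, by evaluating
    two quadratic-form bounds at [v + Ahat v] and [v - Ahat v]. *)

Lemma normal_pdf01E (x : R) :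
  phi x = (normal_peak 1 * expR (- (x ^+ 2 / 2)))%R.
Proof.
by rewrite normal_pdfE ?oner_neq0// /normal_fun subr0 expr1n mulNr.
Qed.

(** The Radon-Nikodym derivative of the normal law agrees almost everywhere with [phi], since both
    have the same integral over every measurable set. *)
Lemma ge0_integral_std_normal (f : R -> \bar R) :
  measurable_fun [set: R] f -> (forall x, 0 <= f x) ->
  \int[gauss]_x f x = \int[mu]_x (f x * (phi x)%:E).
Proof.
move=> mf f0.
have gmu : gauss `<< mu := normal_prob_dominates 0 1.
rewrite -(Radon_Nikodym_SigmaFinite.change_of_variables gmu)//.
have mphi : measurable_fun [set: R] (EFin \o phi).
  by apply/measurable_EFinP; exact: measurable_normal_pdf.
have iRN := Radon_Nikodym_SigmaFinite.f_integrable gmu.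
apply: ae_eq_integral => //.
- by apply: emeasurable_funM => //; exact: measurable_int iRN.
- exact: emeasurable_funM.
- apply: ae_eqe_mul2l; apply: integral_ae_eq => // E _ mE.
  by rewrite -Radon_Nikodym_SigmaFinite.f_integral.
Qed.

Lemma ge0_integral_std_normalN (f : R -> \bar R) :
  measurable_fun [set: R] f -> (forall x, 0 <= f x) ->
  \int[gauss]_x f (- x)%R = \int[gauss]_x f x.
Proof.
move=> mf f0.
have mN : @measurable_fun _ _ (measurableTypeR R) (measurableTypeR R) setT -%R by [].
have mphi : measurable_fun [set: R] (EFin \o phi).
  by apply/measurable_EFinP; exact: measurable_normal_pdf.
rewrite !ge0_integral_std_normal//; last exact: measurableT_comp.
have mg : measurable_fun [set: R] (fun x => f x * (phi x)%:E).
  exact: emeasurable_funM.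
have g0 : {in [set: R], forall x, 0 <= f x * (phi x)%:E}.
  by move=> x _; rewrite mule_ge0// lee_fin normal_pdf_ge0.
have := @ge0_integral_pushforward _ _ (measurableTypeR R) (measurableTypeR R) R
  _ mN mu setT _ measurableT mg g0.
rewrite preimage_setT => /esym E.
transitivity (\int[mu]_x ((fun x => f x * (phi x)%:E) \o -%R) x).
  by apply: eq_integral => x _ /=; congr (_ * _); rewrite !normal_pdf01E sqrrN.
apply: (etrans E).
by apply: eq_measure_integral => A mA _; exact: lebesgue_measureN.
Qed.

(** The event is an interval of length [2 * s / |b|], on which the density is at most its peak. *)
Lemma std_normal_itv_le (c s b : R) : (0 < s)%R -> b != 0%R ->
  gauss [set x | `|c + b * x| < s]%R <= (normal_peak 1 * (2 * s / `|b|))%:E.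
Proof.
move=> s0 b0.
have nb0 : (0 < `|b|)%R by rewrite normr_gt0.
have -> : [set x | `|c + b * x| < s]%R =
    `] (- c / b - s / `|b|)%R, (- c / b + s / `|b|)%R [%classic.
  apply/seteqP; split => x /=; rewrite in_itv/= -ltr_distl;
    rewrite -(ltr_pM2r nb0 _ (s / _)%R) divfK ?gt_eqF// -normrM mulrBl divfK//;
    rewrite opprK addrC [(x * b)%R]mulrC.
    by [].
  by [].
rewrite /normal_prob.
apply: (@le_trans _ _ (\int[mu]_(x in `](- c / b - s / `|b|)%R,
    (- c / b + s / `|b|)%R[) (normal_peak (1 : R))%:E)).
  apply: ge0_le_integral => //=.
  - by move=> x _; rewrite lee_fin normal_pdf_ge0.
  - by apply/measurable_EFinP/measurable_funTS; exact: measurable_normal_pdf.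
  - by move=> x _; rewrite lee_fin normal_pdf_ub ?oner_neq0.
rewrite integral_cst//= lebesgue_measure_itv/= lte_fin ifT; last first.
  by rewrite ltrD2l gtrN ?divr_gt0.
rewrite -EFinB -EFinM lee_fin le_eqVlt; apply/orP; left; apply/eqP; ring.
Qed.

End std_normal.

(** * Second moment of the standard normal law *)

Section std_normal2.
Context {R : realType}.
Local Notation mu := (@lebesgue_measure R).
Local Notation gauss := (@normal_prob R 0 1).
Local Notation phi := (@normal_pdf R 0 1).

(** This antiderivative of [(1 - x^2) phi] is what compares the integral of [x^2 phi] with that of
    [phi]. *)
Lemma is_derive_mulx_normal_pdf (x : R) :
  is_derive x 1 (fun y => y * phi y) ((1 - x ^+ 2) * phi x).
Proof.
have -> : (fun y => y * phi y) =
    (fun y => y * (normal_peak 1 * expR (- (2^-1 * y ^+ 2)))).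
  by apply/funext => y; rewrite normal_pdf01E [_ / 2]mulrC.
have dsq : is_derive x 1 (fun y : R => - (2^-1 * y ^+ 2)) (- x).
  apply: is_derive_eq; rewrite /GRing.scale/=. lra.
have dexp : is_derive x 1 (fun y : R => expR (- (2^-1 * y ^+ 2)))
    (expR (- (2^-1 * x ^+ 2)) * - x).
  by apply: (@is_derive1_comp R expR (fun y : R => - (2^-1 * y ^+ 2))).
apply: is_derive_eq.
rewrite normal_pdf01E [_ / 2]mulrC /GRing.scale/=; ring.
Qed.

Lemma cvg_mulx_normal_pdf : x * phi x @[x --> +oo] --> (0 : R).
Proof.
apply: (@squeeze_cvgr _ _ _ _ (cst 0) (fun x => (2 * normal_peak 1) * x^-1)).
- near=> x; have x0 : 0 < x by near: x; exact: nbhs_pinfty_gt.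
  rewrite /cst mulr_ge0 ?normal_pdf_ge0 ?(ltW x0)//=.
  rewrite normal_pdf01E mulrCA [2 * normal_peak 1]mulrC -(mulrA _ 2).
  apply: ler_wpM2l; first exact: normal_peak_ge0.
  rewrite ler_pdivlMr// expRN mulrAC -expr2 ler_pdivrMr ?expR_gt0//.
  (* The bound [2 * normal_peak 1 / x] amounts to [x^2 <= 2 exp(x^2/2)]. *)
  have := expR_ge1Dx (x ^+ 2 / 2); lra.
- exact: cvg_cst.
- rewrite -[X in _ --> X](mulr0 (2 * normal_peak 1)).
  apply: cvgM; first exact: cvg_cst.
  apply/gtr0_cvgV0; first exact: nbhs_pinfty_gt.
  exact: cvg_id.
Unshelve. all: by end_near. Qed.

Lemma continuous_mulsq_normal_pdf : continuous (fun x : R => x ^+ 2 * phi x).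
Proof.
move=> x; apply: cvgM; first exact: exprn_continuous.
by apply: continuous_normal_pdf; rewrite oner_neq0.
Qed.

Local Open Scope ereal_scope.

(** The half-line is cut at 1, where [1 - x^2] changes sign, so that only nonnegative functions are
    integrated on each piece. The fundamental theorem of calculus produces [phi 1] on both pieces,
    with opposite effects that cancel in the sum. *)
Lemma integral0y_mulsq_normal_pdf :
  \int[mu]_(x in `[0%R, +oo[) (x ^+ 2 * phi x)%:E =
  \int[mu]_(x in `[0%R, +oo[) (phi x)%:E.
Proof.
have mphi : measurable_fun [set: R] (EFin \o phi).
  by apply/measurable_EFinP; exact: measurable_normal_pdf.
have msq : measurable_fun [set: R] (fun x => (x ^+ 2 * phi x)%:E).
  apply/measurable_EFinP; apply: continuous_measurable_fun.
  exact: continuous_mulsq_normal_pdf.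
have cphi : continuous phi by apply: continuous_normal_pdf; rewrite oner_neq0.
have split01 (f : R -> R) : measurable_fun [set: R] (EFin \o f) ->
    (forall x, 0 <= f x)%R ->
    \int[mu]_(x in `[0%R, +oo[) (f x)%:E =
    \int[mu]_(x in `[0%R, 1%R]) (f x)%:E + \int[mu]_(x in `[1%R, +oo[) (f x)%:E.
  move=> mf f0.
  have -> : `[(0 : R)%R, +oo[%classic = `[0%R, 1%R] `|` `]1%R, +oo[.
    by apply: (@itv_bndbnd_setU _ R _ (BRight 1%R)); rewrite ?bnd_simp.
  rewrite ge0_integral_setU//=.
  - by rewrite integral_itv_obnd_cbnd//; exact: measurable_funTS.
  - exact: measurable_funTS.
  - by move=> x _; rewrite lee_fin.
  - apply/disj_setPS => x /= []; rewrite !in_itv/= => /andP[_ x1].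
    by rewrite andbT ltNge x1.
rewrite !split01//; last 2 first.
- by move=> x; rewrite normal_pdf_ge0.
- by move=> x; rewrite mulr_ge0 ?sqr_ge0 ?normal_pdf_ge0.
have cF : continuous (fun x : R => x * phi x)%R.
  by move=> x; apply: cvgM; [exact: cvg_id|exact: cphi].
have cf : continuous (fun x : R => (1 - x ^+ 2) * phi x)%R.
  move=> x; apply: cvgM; last exact: cphi.
  by apply: cvgB; [exact: cvg_cst|exact: exprn_continuous].
have dF (x : R) : derivable (fun x : R => x * phi x)%R x 1.
  by have := is_derive_mulx_normal_pdf x => -[].
have F' (x : R) : ((fun x : R => x * phi x)^`()%classic x = (1 - x ^+ 2) * phi x)%R.
  by rewrite derive1E; have := is_derive_mulx_normal_pdf x => -[].
have I01 : \int[mu]_(x in `[0%R, 1%R]) ((1 - x ^+ 2) * phi x)%:E = (phi 1)%:E.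
  rewrite (@continuous_FTC2 _ _ (fun x : R => x * phi x)%R)//.
  - by rewrite mul1r mul0r oppe0 adde0.
  - exact: continuous_subspaceT.
  - by split => //; [apply: cvg_at_right_filter|apply: cvg_at_left_filter];
      exact: cF.
have I1y : \int[mu]_(x in `[1%R, +oo[) ((x ^+ 2 - 1) * phi x)%:E = (phi 1)%:E.
  rewrite (@ge0_continuous_FTC2y _ _ (fun x : R => - (x * phi x))%R _ 0%R)//.
  - by rewrite mul1r sub0e EFinN oppeK.
  - move=> x x1; rewrite mulr_ge0 ?normal_pdf_ge0// subr_ge0.
    by rewrite exprn_ege1.
  - apply: continuous_subspaceT => x; apply: cvgM; last exact: cphi.
    by apply: cvgB; [exact: exprn_continuous|exact: cvg_cst].
  - by have := cvgN cvg_mulx_normal_pdf; rewrite oppr0; apply.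
  - by move=> x _; apply: derivableN.
  - by apply: cvg_at_right_filter; apply: cvgN; exact: cF.
  - move=> x _; rewrite derive1E deriveN// -derive1E F'; ring.
have mf01 : measurable_fun [set: R] (fun x => ((1 - x ^+ 2) * phi x)%:E).
  by apply/measurable_EFinP; exact: continuous_measurable_fun.
have mf1y : measurable_fun [set: R] (fun x => ((x ^+ 2 - 1) * phi x)%:E).
  apply/measurable_EFinP; apply: continuous_measurable_fun => x.
  apply: cvgM; last exact: cphi.
  by apply: cvgB; [exact: exprn_continuous|exact: cvg_cst].
have -> : \int[mu]_(x in `[1%R, +oo[) (x ^+ 2 * phi x)%:E =
    (phi 1)%:E + \int[mu]_(x in `[1%R, +oo[) (phi x)%:E.
  rewrite -I1y -ge0_integralD//=.
  - by apply: eq_integral => x _; rewrite -EFinD; congr (_%:E); ring.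
  - move=> x; rewrite in_itv/= andbT => x1.
    by rewrite lee_fin mulr_ge0 ?normal_pdf_ge0// subr_ge0 exprn_ege1.
  - exact: measurable_funTS.
  - by move=> x _; rewrite lee_fin normal_pdf_ge0.
  - exact: measurable_funTS.
have -> : \int[mu]_(x in `[0%R, 1%R]) (phi x)%:E =
    (phi 1)%:E + \int[mu]_(x in `[0%R, 1%R]) (x ^+ 2 * phi x)%:E.
  rewrite -I01 -ge0_integralD//=.
  - by apply: eq_integral => x _; rewrite -EFinD; congr (_%:E); ring.
  - move=> x; rewrite in_itv/= => /andP[x0 x1].
    by rewrite lee_fin mulr_ge0 ?normal_pdf_ge0// subr_ge0 exprn_ile1.
  - exact: measurable_funTS.
  - by move=> x _; rewrite lee_fin mulr_ge0 ?sqr_ge0 ?normal_pdf_ge0.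
  - exact: measurable_funTS.
by rewrite addeCA addeA.
Qed.

Lemma std_normal_second_moment : \int[gauss]_x (x ^+ 2)%:E = 1.
Proof.
have even_phi (x : R) : phi (- x)%R = phi x by rewrite !normal_pdf01E sqrrN.
rewrite ge0_integral_std_normal; last 2 first.
- apply/measurable_EFinP; apply: continuous_measurable_fun.
  exact: exprn_continuous.
- by move=> x; rewrite lee_fin sqr_ge0.
under eq_integral do rewrite -EFinM.
rewrite ge0_symfun_integralT; last 3 first.
- by move=> x; rewrite mulr_ge0 ?sqr_ge0 ?normal_pdf_ge0.
- exact: continuous_mulsq_normal_pdf.
- by move=> x /=; rewrite sqrrN even_phi.
rewrite -set_itvcy integral0y_mulsq_normal_pdf set_itvcy.
rewrite -ge0_symfun_integralT ?integral_normal_pdf//.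
- by move=> x; rewrite normal_pdf_ge0.
- by apply: continuous_normal_pdf; rewrite oner_neq0.
- by move=> x /=; rewrite even_phi.
Qed.

(** Adding the integrals for [b] and [- b], equal by symmetry, removes the cross term before any
    signed function has to be integrated. *)
Lemma std_normal_sq_affine (a b : R) :
  \int[gauss]_x ((a + b * x) ^+ 2)%:E = (a ^+ 2 + b ^+ 2)%:E.
Proof.
have mx (u v : R) : measurable_fun [set: R] (fun x : R => ((u + v * x) ^+ 2)%:E).
  by apply/measurable_EFinP/measurable_funX/measurable_funD => //;
    exact: measurable_funM.
pose I (v : R) := \int[gauss]_x ((a + v * x) ^+ 2)%:E.
have p0 (v x : R) : 0 <= ((a + v * x) ^+ 2)%:E by rewrite lee_fin sqr_ge0.
have IN : I b = I (- b)%R.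
  rewrite /I -(ge0_integral_std_normalN (mx a b) (p0 b)).
  by apply: eq_integral => x _; rewrite mulrN mulNr.
have : I b + I (- b)%R = (2 * (a ^+ 2 + b ^+ 2))%:E.
  rewrite /I -(ge0_integralD gauss measurableT (fun x _ => p0 b x) (mx a b)
    (fun x _ => p0 (- b)%R x) (mx a (- b)%R)).
  transitivity (\int[gauss]_x ((2 * a ^+ 2)%:E + (2 * b ^+ 2)%:E * (x ^+ 2)%:E)).
    by apply: eq_integral => x _; rewrite -EFinM -!EFinD; congr (_%:E); ring.
  have msq : measurable_fun [set: R] (fun x : R => (x ^+ 2)%:E).
    exact/measurable_EFinP/measurable_funX.
  rewrite ge0_integralD//; first last.
  - exact: measurable_funeM.
  - by move=> x _; rewrite mule_ge0 ?lee_fin ?sqr_ge0// mulr_ge0 ?sqr_ge0.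
  - by move=> x _; rewrite lee_fin mulr_ge0 ?sqr_ge0.
  rewrite integral_cst// ge0_integralZl//; last 2 first.
  - by move=> x _; rewrite lee_fin sqr_ge0.
  - by rewrite lee_fin mulr_ge0 ?sqr_ge0.
  rewrite [X in _ * X + _](_ : _ = 1); last exact: (@probability_setT _ _ _ gauss).
  rewrite std_normal_second_moment !mule1 -EFinD.
  by congr (_%:E); ring.
rewrite -IN -/(I b).
(* An infinite [I b] is excluded because [I b + I b] is a real number. *)
case: (I b) => [r| |]//; rewrite -EFinD => -[] rr; congr (_%:E); lra.
Qed.

End std_normal2.

(** * Standard Gaussian coordinates *)

Section gauss_coordinates.
Context {R : realType}.
Local Notation gauss := (@normal_prob R 0 1).
Implicit Types (v : nat -> R) (f : (nat -> R) -> R).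

Definition upd v (j : nat) (x : R) : nat -> R := fun i => if i == j then x else v i.

Lemma updd v j x : upd v j x j = x.
Proof. by rewrite /upd eqxx. Qed.

Lemma upd_upd v j x y : upd (upd v j x) j y = upd v j y.
Proof. by apply/funext => i; rewrite /upd; case: eqP. Qed.

Lemma updC v j k x y : j != k -> upd (upd v j x) k y = upd (upd v k y) j x.
Proof.
move=> jk; apply/funext => i; rewrite /upd.
by case: eqP => [->|//]; rewrite eq_sym (negbTE jk).
Qed.

(* Stands for measurability with respect to the product sigma-algebra on
   [nat -> R], tested along all families of measurable coordinates. *)
Definition coord_measurable f : Prop :=
  forall d (T : measurableType d) (z : T -> nat -> R),
    (forall i, measurable_fun [set: T] (fun t => z t i)) ->
    measurable_fun [set: T] (fun t => f (z t)).

Lemma coord_measurable_upd f j x :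
  coord_measurable f -> coord_measurable (fun v => f (upd v j x)).
Proof.
move=> mf d T z mz; apply: mf => i; rewrite /upd.
by case: eqP => _; [exact: measurable_cst|exact: mz].
Qed.

(** Integrability that can be checked pointwise: the bound has a finite mean because each second
    moment is 1, and it survives freezing a coordinate. *)
Definition quad_growth (k : nat) f : Prop :=
  exists a b : R, forall v, `|f v| <= a + b * \sum_(i < k) v i ^+ 2.

Lemma quad_growth_upd k f x :
  quad_growth k.+1 f -> quad_growth k (fun v => f (upd v k x)).
Proof.
move=> [a [b fab]]; exists (a + b * x ^+ 2), b => v.
apply: (le_trans (fab _)); rewrite big_ord_recr/= updd.
rewrite (eq_bigr (fun i : 'I_k => v i ^+ 2)); first by rewrite mulrDr; lra.
by move=> i _; rewrite /upd ltn_eqF.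
Qed.

Local Open Scope ereal_scope.

(* By Tonelli the second clause holds when the first [k] coordinates are i.i.d.
   standard normal; it is the only consequence of independence that is needed. *)
Definition gauss_coords (k : nat) d (T : measurableType d) (P : probability T R)
    (Z : T -> nat -> R) : Prop :=
  (forall i, measurable_fun [set: T] (fun t => Z t i)) /\
  (forall j f, (j < k)%N -> coord_measurable f -> (forall v, 0 <= f v)%R ->
    \int[P]_t (f (Z t))%:E = \int[P]_t \int[gauss]_x (f (upd (Z t) j x))%:E).

Lemma probability_integral_cst d (T : measurableType d) (P : probability T R)
  (c : \bar R) : \int[P]_t c = c.
Proof.
rewrite (_ : (fun=> c) = cst c)// integral_cst//.
by rewrite [X in _ * X](_ : _ = 1) ?mule1//; exact: probability_setT.
Qed.

Section gauss_coords_theory.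
Context (k : nat) d (T : measurableType d) (P : probability T R)
  (Z : T -> nat -> R).
Hypothesis PZ : gauss_coords k P Z.

Lemma gauss_coords_measurable f : coord_measurable f ->
  measurable_fun [set: T] (fun t => (f (Z t))%:E).
Proof. by move=> mf; apply/measurable_EFinP; apply: mf; exact: PZ.1. Qed.

Lemma gauss_coords_sq j : (j < k)%N -> \int[P]_t (Z t j ^+ 2)%:E = 1.
Proof.
move=> jk; have mf : coord_measurable (fun v => v j ^+ 2)%R.
  by move=> ? ? z mz; apply: measurable_funX; exact: mz.
rewrite (PZ.2 j _ jk mf) => [|v]; last exact: sqr_ge0.
under eq_integral => t _.
  under eq_integral do rewrite updd.
  rewrite std_normal_second_moment.
  over.
exact: probability_integral_cst.
Qed.

Lemma gauss_coords_integrable f : coord_measurable f -> quad_growth k f ->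
  P.-integrable [set: T] (fun t => (f (Z t))%:E).
Proof.
move=> mf [a [b fab]].
apply: (@le_integrable _ _ _ _ _ measurableT _
    (fun t => (a + b * \sum_(i < k) Z t i ^+ 2)%:E)).
- exact: gauss_coords_measurable.
- move=> t _ /=; rewrite lee_fin; apply: (le_trans (fab _)); exact: ler_norm.
under eq_fun do rewrite EFinD EFinM -sumEFin.
apply: integrableD => //; first exact: finite_measure_integrable_cst.
apply: integrableZl => //; apply: integrable_sum => // i _.
apply/integrableP; split.
  by apply/measurable_EFinP/measurable_funX; exact: PZ.1.
under eq_integral do rewrite /= ger0_norm ?sqr_ge0//.
by rewrite gauss_coords_sq// ltry.
Qed.

Let Z' (xt : measurableTypeR R * T) := upd (Z xt.2) k xt.1.

Let mZ' i : measurable_fun [set: measurableTypeR R * T] (fun xt => Z' xt i).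
Proof.
rewrite /Z' /upd; case: eqP => _; first exact: measurable_fst.
by apply: (measurableT_comp (PZ.1 i)); exact: measurable_snd.
Qed.

Let meas_inner f j : coord_measurable f -> (forall v, 0 <= f v)%R ->
  measurable_fun [set: T] (fun t => \int[gauss]_x (f (upd (Z t) j x))%:E).
Proof.
move=> mf f0.
apply: (@measurable_fun_fubini_tonelli_G _ _ (measurableTypeR R) T R gauss
  (fun xt => (f (upd (Z xt.2) j xt.1))%:E)).
- apply/measurable_EFinP; apply: mf => i; rewrite /upd.
  case: eqP => _; first exact: measurable_fst.
  by apply: (measurableT_comp (PZ.1 i)); exact: measurable_snd.
- by move=> xt; rewrite lee_fin.
Qed.

(** Resampling the new coordinate [k] overwrites the first factor of the product, so its own
    integral becomes that of a constant. An older coordinate is resampled with [k] frozen, where the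
    hypothesis on [Z] applies because updates at distinct places commute. *)
Lemma gauss_coordsS : gauss_coords k.+1 (gauss \x P) Z'.
Proof.
split; first exact: mZ'.
move=> j f; rewrite ltnS leq_eqVlt => jk mf f0.
have mfZ : measurable_fun [set: measurableTypeR R * T] (fun xt => (f (Z' xt))%:E).
  by apply/measurable_EFinP; apply: mf; exact: mZ'.
have f0Z (xt : measurableTypeR R * T) : 0 <= (f (Z' xt))%:E by rewrite lee_fin.
case/predU1P: jk => [->{j}|jk].
  rewrite fubini_tonelli2//= /fubini_G/=.
  under [RHS]eq_integral => xt _ do under eq_integral do rewrite upd_upd.
  rewrite (fubini_tonelli2 (fun xt => \int[gauss]_x (f (upd (Z xt.2) k x))%:E))/=.
  - apply: eq_integral => t _; rewrite /fubini_G/=.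
    by rewrite (@probability_integral_cst _ _ gauss).
  - exact: (measurableT_comp (meas_inner k mf f0) measurable_snd).
  - by move=> xt; apply: integral_ge0 => x _; rewrite lee_fin.
apply: (etrans (fubini_tonelli1 (m1 := gauss) (m2 := P) _ mfZ f0Z)).
have mg : measurable_fun [set: measurableTypeR R * T]
    (fun xt => \int[gauss]_x (f (upd (Z' xt) j x))%:E).
  apply: (@measurable_fun_fubini_tonelli_G _ _ (measurableTypeR R)
    (measurableTypeR R * T)%type R gauss
    (fun xt => (f (upd (Z' xt.2) j xt.1))%:E)).
  - apply/measurable_EFinP; apply: mf => i; rewrite /upd.
    case: eqP => _; first exact: measurable_fst.
    by apply: (measurableT_comp (mZ' i)); exact: measurable_snd.
  - by move=> xt; rewrite lee_fin.
have g0 (xt : measurableTypeR R * T) :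
    0 <= \int[gauss]_x (f (upd (Z' xt) j x))%:E.
  by apply: integral_ge0 => x _; rewrite lee_fin.
apply: (etrans _ (esym (fubini_tonelli1 (m1 := gauss) (m2 := P) _ mg g0))).
apply: eq_integral => x _; rewrite /fubini_F/=.
rewrite (PZ.2 j (fun v => f (upd v k x)) jk (coord_measurable_upd _ _ mf))//.
apply: eq_integral => t _; apply: eq_integral => y _.
by rewrite /Z' updC// ltn_eqF.
Qed.

End gauss_coords_theory.

(** On the right-hand side linearity and monotonicity are those of the integral. Quadratic growth
    makes a signed [f] integrable, so that Fubini's theorem can peel off the outermost integral in
    the induction. *)
Lemma stdGaussE_repr (k : nat) :
  exists d (T : measurableType d) (P : probability T R) (Z : T -> nat -> R),
    gauss_coords k P Z /\
    forall f, coord_measurable f -> quad_growth k f ->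
      stdGaussE k (fun v => (f v)%:E) = \int[P]_t (f (Z t))%:E.
Proof.
elim: k => [|k [d [T [P [Z [PZ IH]]]]]].
  exists _, (measurableTypeR R), gauss, (fun _ _ => 0%R); split.
    by split=> // i; exact: measurable_cst.
  move=> f _ _ /=; rewrite integral_cst//.
  by rewrite [X in _ * X](_ : _ = 1) ?mule1//; exact: (@probability_setT _ _ _ gauss).
exists _, (measurableTypeR R * T)%type, (gauss \x P)%E,
  (fun xt => upd (Z xt.2) k xt.1); split; first exact: gauss_coordsS.
move=> f mf qf.
have iZ' := gauss_coords_integrable (gauss_coordsS PZ) mf qf.
rewrite -integral12_prod_meas1//=.
apply: eq_integral => x _; rewrite /fubini_F/=.
rewrite -(IH (fun v => f (upd v k x)))//.
  exact: coord_measurable_upd.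
exact: quad_growth_upd.
Qed.

End gauss_coordinates.

(** * Expectation, symmetry and covariances of Gaussian coordinates *)

Section gauss_expectation.
Context {R : realType}.
Local Notation gauss := (@normal_prob R 0 1).
Implicit Types (v : nat -> R) (f g : (nat -> R) -> R) (k : nat).

Definition admissible k f : Prop := coord_measurable f /\ quad_growth k f.

(** Plays the role of L2 where [admissible] plays that of L1: products of two such functions are
    admissible. *)
Definition sq_admissible k f : Prop :=
  coord_measurable f /\ quad_growth k (fun v => f v ^+ 2).

Lemma admissible_bounded k f (a b : R) : coord_measurable f ->
  (forall v, `|f v| <= a + b * \sum_(i < k) v i ^+ 2) -> admissible k f.
Proof. by move=> mf fab; split=> //; exists a, b. Qed.

Lemma admissible_le k f g : coord_measurable f -> admissible k g ->
  (forall v, `|f v| <= g v) -> admissible k f.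
Proof.
move=> mf [_ [a [b gab]]] fg; split=> //; exists a, b => v.
by apply: (le_trans (fg v)); apply: (le_trans (ler_norm _)).
Qed.

Lemma admissible_cst k (c : R) : admissible k (fun=> c).
Proof.
apply: (@admissible_bounded _ _ `|c| 0) => [d T z _|v]; first exact: measurable_cst.
by rewrite mul0r addr0.
Qed.

Lemma admissibleD k f g :
  admissible k f -> admissible k g -> admissible k (fun v => f v + g v).
Proof.
move=> [mf [a [b fab]]] [mg [a' [b' gab]]]; split.
  by move=> d T z mz; apply: measurable_funD; [exact: mf|exact: mg].
exists (a + a'), (b + b') => v; apply: (le_trans (ler_normD _ _)).
by rewrite mulrDl addrACA; apply: lerD.
Qed.

Lemma admissibleZ k (c : R) f : admissible k f -> admissible k (fun v => c * f v).
Proof.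
move=> [mf [a [b fab]]]; split.
  move=> d T z mz; apply: measurable_funM; first exact: measurable_cst.
  exact: mf.
exists (`|c| * a), (`|c| * b) => v; rewrite normrM -mulrA -mulrDr.
by rewrite ler_wpM2l.
Qed.

Lemma admissible_sum k (I : Type) (r : seq I) (Q : pred I)
    (F : I -> (nat -> R) -> R) :
  (forall i, admissible k (F i)) -> admissible k (fun v => \sum_(i <- r | Q i) F i v).
Proof.
move=> aF; elim: r => [|i r IH].
  under [X in admissible _ X]eq_fun do rewrite big_nil.
  exact: admissible_cst.
under [X in admissible _ X]eq_fun do rewrite big_cons.
by case: (Q i) => //; exact: admissibleD.
Qed.

Lemma admissibleM k f g :
  sq_admissible k f -> sq_admissible k g -> admissible k (fun v => f v * g v).
Proof.
move=> [mf qf] [mg qg].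
apply: (@admissible_le _ _ (fun v => f v ^+ 2 + g v ^+ 2)).
- by move=> d T z mz; apply: measurable_funM; [exact: mf|exact: mg].
- apply: admissibleD; split=> // d T z mz; apply: measurable_funX;
    [exact: mf|exact: mg].
- move=> v; rewrite normrM -(real_normK (num_real (f v))).
  rewrite -(real_normK (num_real (g v))).
  by have := sqr_ge0 (`|f v| - `|g v|);
     have := sqr_ge0 `|f v|; have := sqr_ge0 `|g v|; nra.
Qed.

Lemma sq_admissible_sqr k f : sq_admissible k f -> admissible k (fun v => f v ^+ 2).
Proof. by move=> /[dup]; exact: admissibleM. Qed.

Lemma sq_admissible_le k f g (c : R) : coord_measurable f -> sq_admissible k g ->
  (forall v, f v ^+ 2 <= c * g v ^+ 2) -> sq_admissible k f.
Proof.
move=> mf ag fg; split=> //.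
have mf2 : coord_measurable (fun v => f v ^+ 2).
  by move=> d T z mz; apply: measurable_funX; exact: mf.
have fg2 v : `|f v ^+ 2| <= c * g v ^+ 2 by rewrite ger0_norm ?sqr_ge0.
exact: (admissible_le mf2 (admissibleZ c (sq_admissible_sqr ag)) fg2).2.
Qed.

Lemma sq_admissible_coord k j : (j < k)%N -> sq_admissible k (fun v => v j).
Proof.
move=> jk; split; first by move=> d T z; exact.
exists 0, 1 => v; rewrite add0r mul1r ger0_norm ?sqr_ge0//.
rewrite (bigD1 (Ordinal jk))//= lerDl sumr_ge0// => i _; exact: sqr_ge0.
Qed.

Lemma sq_admissibleD k f g :
  sq_admissible k f -> sq_admissible k g -> sq_admissible k (fun v => f v + g v).
Proof.
move=> af ag; split.
  by move=> d T z mz; apply: measurable_funD; [exact: af.1|exact: ag.1].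
have -> : (fun v => (f v + g v) ^+ 2) =
    (fun v => (f v ^+ 2 + g v ^+ 2) + 2 * (f v * g v)).
  by apply/funext => v; ring.
apply: (admissibleD (admissibleD _ _) (admissibleZ 2 _)).2.
- exact: sq_admissible_sqr.
- exact: sq_admissible_sqr.
- exact: admissibleM.
Qed.

Lemma sq_admissibleZ k (c : R) f :
  sq_admissible k f -> sq_admissible k (fun v => c * f v).
Proof.
move=> af; apply: (@sq_admissible_le _ _ f (c ^+ 2)) => //.
- move=> d T z mz; apply: measurable_funM; first exact: measurable_cst.
  exact: af.1.
- by move=> v; rewrite exprMn.
Qed.

Lemma sq_admissible_sum k (I : Type) (r : seq I) (F : I -> (nat -> R) -> R) :
  (forall i, sq_admissible k (F i)) ->
  sq_admissible k (fun v => \sum_(i <- r) F i v).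
Proof.
move=> aF; elim: r => [|i r IH].
  under [X in sq_admissible _ X]eq_fun do rewrite big_nil.
  split; first by move=> d T z _; exact: measurable_cst.
  by rewrite expr0n; exact: (admissible_cst k 0).2.
under [X in sq_admissible _ X]eq_fun do rewrite big_cons.
exact: sq_admissibleD.
Qed.

Definition gaussE k f : R := fine (stdGaussE k (fun v => (f v)%:E)).

Lemma stdGaussE_fin k f : admissible k f ->
  stdGaussE k (fun v => (f v)%:E) = (gaussE k f)%:E.
Proof.
move=> [mf qf]; rewrite /gaussE fineK//.
have [d [T [P [Z [PZ E]]]]] := @stdGaussE_repr R k.
by rewrite E//; apply: (integrable_fin_num measurableT (gauss_coords_integrable PZ mf qf)).
Qed.

Lemma gaussED k f g : admissible k f -> admissible k g ->
  gaussE k (fun v => f v + g v) = gaussE k f + gaussE k g.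
Proof.
move=> af ag; apply: EFin_inj; rewrite EFinD -!stdGaussE_fin//; last exact: admissibleD.
have [d [T [P [Z [PZ E]]]]] := @stdGaussE_repr R k.
have [mf qf] := af; have [mg qg] := ag; have [mfg qfg] := admissibleD af ag.
by rewrite !E// -integralD//; exact: (gauss_coords_integrable PZ).
Qed.

Lemma gaussEZ k (c : R) f : admissible k f ->
  gaussE k (fun v => c * f v) = c * gaussE k f.
Proof.
move=> af; apply: EFin_inj; rewrite EFinM -!stdGaussE_fin//; last exact: admissibleZ.
have [d [T [P [Z [PZ E]]]]] := @stdGaussE_repr R k.
have [mf qf] := af; have [mcf qcf] := admissibleZ c af.
by rewrite !E// -integralZl//; exact: (gauss_coords_integrable PZ).
Qed.

Lemma gaussE_cst k (c : R) : gaussE k (fun=> c) = c.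
Proof.
apply: EFin_inj; rewrite -stdGaussE_fin; last exact: admissible_cst.
have [d [T [P [Z [PZ E]]]]] := @stdGaussE_repr R k.
have [mc qc] := admissible_cst k c.
by rewrite E// probability_integral_cst.
Qed.

Lemma gaussE_sum k (I : Type) (r : seq I) (Q : pred I) (F : I -> (nat -> R) -> R) :
  (forall i, admissible k (F i)) ->
  gaussE k (fun v => \sum_(i <- r | Q i) F i v) = \sum_(i <- r | Q i) gaussE k (F i).
Proof.
move=> aF; elim: r => [|i r IH].
  under [X in gaussE _ X]eq_fun do rewrite big_nil.
  by rewrite big_nil gaussE_cst.
under [X in gaussE _ X]eq_fun do rewrite big_cons.
rewrite big_cons; case: (Q i); last exact: IH.
by rewrite gaussED ?IH//; exact: admissible_sum.
Qed.

Lemma le_gaussE k f g : admissible k f -> admissible k g ->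
  (forall v, f v <= g v) -> gaussE k f <= gaussE k g.
Proof.
move=> af ag fg; rewrite -lee_fin -!stdGaussE_fin//.
have [d [T [P [Z [PZ E]]]]] := @stdGaussE_repr R k.
have [mf qf] := af; have [mg qg] := ag.
rewrite !E//; apply: le_integral => //; try exact: (gauss_coords_integrable PZ).
by move=> t _; rewrite lee_fin.
Qed.

Lemma gaussE_ge0 k f : admissible k f -> (forall v, 0 <= f v) -> 0 <= gaussE k f.
Proof.
by move=> af f0; rewrite -(gaussE_cst k 0) le_gaussE//; exact: admissible_cst.
Qed.

(** After resampling [j] on both sides, only the symmetry of the one-dimensional normal law is left
    to use. *)
Lemma gaussE_flip k j f : (j < k)%N -> admissible k f -> (forall v, 0 <= f v) ->
  gaussE k (fun v => f (upd v j (- v j))) = gaussE k f.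
Proof.
move=> jk af f0; have [mf qf] := af.
have mf' : coord_measurable (fun v => f (upd v j (- v j))).
  move=> d T z mz; apply: mf => i; rewrite /upd; case: eqP => _ //.
  by apply: measurableT_comp => //; exact: mz.
have qf' : quad_growth k (fun v => f (upd v j (- v j))).
  have [a [b fab]] := qf; exists a, b => v; apply: (le_trans (fab _)).
  rewrite (eq_bigr (fun i : 'I_k => v i ^+ 2))// => i _; rewrite /upd.
  by case: eqP => [->|//]; rewrite sqrrN.
apply: EFin_inj; rewrite -!stdGaussE_fin//.
have [d [T [P [Z [PZ E]]]]] := @stdGaussE_repr R k.
rewrite !E// (PZ.2 j f)// (PZ.2 j (fun v => f (upd v j (- v j))))//.
apply: eq_integral => t _.
rewrite -(@ge0_integral_std_normalN _ (fun x => (f (upd (Z t) j x))%:E)).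
- by apply: eq_integral => x _; rewrite updd upd_upd.
- apply/measurable_EFinP; apply: (mf _ _ (fun x => upd (Z t) j x)) => i.
  by rewrite /upd; case: eqP => _; [exact: measurable_id|exact: measurable_cst].
- by move=> x; rewrite lee_fin.
Qed.

Definition neg_below k v : nat -> R := fun i => if (i < k)%N then - v i else v i.

(** Signs are flipped one coordinate at a time. Admissibility is carried through the induction
    because each flip requires it. *)
Lemma gaussE_neg k f : admissible k f -> (forall v, 0 <= f v) ->
  gaussE k (fun v => f (neg_below k v)) = gaussE k f.
Proof.
move=> af f0.
suff H m : (m <= k)%N -> admissible k (fun v => f (neg_below m v)) /\
    gaussE k (fun v => f (neg_below m v)) = gaussE k f by exact: (H k (leqnn k)).2.
elim: m => [_|m IH mk].
  by rewrite (_ : (fun v => f (neg_below 0 v)) = f).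
have [afm <-] := IH (ltnW mk).
have negS v : neg_below m.+1 v = neg_below m (upd v m (- v m)).
  apply/funext => i; rewrite /neg_below /upd ltnS leq_eqVlt.
  by case: eqP => [->|_]; rewrite ?ltnn.
rewrite (_ : (fun v => f (neg_below m.+1 v)) =
  (fun v => f (neg_below m (upd v m (- v m))))); last first.
  by apply/funext => v; rewrite negS.
split; last by rewrite -(gaussE_flip mk afm).
have [mf [a [b fab]]] := afm; split.
  move=> d T z mz; apply: (mf _ _ (fun t => upd (z t) m (- z t m))) => i.
  rewrite /upd; case: eqP => _ //; apply: measurableT_comp => //; exact: mz.
exists a, b => v; apply: (le_trans (fab _)).
rewrite (eq_bigr (fun i : 'I_k => v i ^+ 2))// => i _; rewrite /upd.
by case: eqP => [->|//]; rewrite sqrrN.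
Qed.

(** The product [v i * v j] is signed, while resampling is stated for nonnegative functions. The
    off-diagonal case is therefore obtained by polarization from the mean of [(v i + v j)^2]. *)
Lemma gaussE_coordM k i j : (i < k)%N -> (j < k)%N ->
  gaussE k (fun v => v i * v j) = (i == j)%:R.
Proof.
move=> ik jk.
have [d [T [P [Z [PZ E]]]]] := @stdGaussE_repr R k.
have sq l : (l < k)%N -> gaussE k (fun v => v l ^+ 2) = 1.
  move=> lk; have al := sq_admissible_sqr (sq_admissible_coord lk).
  apply: EFin_inj; rewrite -stdGaussE_fin// (E _ al.1 al.2).
  exact: gauss_coords_sq PZ _ lk.
case: eqP => [->|/eqP ij]; first exact: sq.
have ai := sq_admissible_coord ik; have aj := sq_admissible_coord jk.
have as2 := sq_admissible_sqr (sq_admissibleD ai aj).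
have : gaussE k (fun v => (v i + v j) ^+ 2) = 2.
  apply: EFin_inj; rewrite -stdGaussE_fin// (E _ as2.1 as2.2).
  rewrite (PZ.2 i _ ik as2.1) => [|v]; last exact: sqr_ge0.
  transitivity (\int[P]_t (1 + (Z t j ^+ 2)%:E))%E.
    apply: eq_integral => t _.
    transitivity (\int[gauss]_x ((Z t j + 1 * x) ^+ 2)%:E)%E.
      by apply: eq_integral => x _; rewrite updd /upd eq_sym (negbTE ij) mul1r addrC.
    by rewrite std_normal_sq_affine expr1n addrC EFinD.
  rewrite ge0_integralD//.
  - rewrite (gauss_coords_sq PZ jk) (@probability_integral_cst _ _ _ P 1%E).
    by rewrite -EFinD.
  - by move=> t _; rewrite lee_fin sqr_ge0.
  - exact: (gauss_coords_measurable PZ (sq_admissible_sqr aj).1).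
rewrite (_ : (fun v => (v i + v j) ^+ 2) =
    (fun v => (v i ^+ 2 + v j ^+ 2) + 2 * (v i * v j))); last first.
  by apply/funext => v; ring.
have ai2 := sq_admissible_sqr ai; have aj2 := sq_admissible_sqr aj.
have aij := admissibleM ai aj.
rewrite (gaussED (admissibleD ai2 aj2) (admissibleZ 2 aij)) (gaussED ai2 aj2).
rewrite (gaussEZ 2 aij) !sq// => h; rewrite mulr0n; lra.
Qed.

(** * Linear forms in distinct Gaussian coordinates *)

Section linear_forms.
Variables (k n : nat) (p : 'I_n -> nat).
Hypotheses (p_inj : injective p) (pk : forall m, (p m < k)%N).
Implicit Types b c : 'I_n -> R.

Lemma sq_admissible_linear b : sq_admissible k (fun v => \sum_m b m * v (p m)).
Proof.
by apply: sq_admissible_sum => m; apply: sq_admissibleZ; exact: sq_admissible_coord.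
Qed.

Lemma gaussE_linearM b c :
  gaussE k (fun v => (\sum_m b m * v (p m)) * (\sum_m c m * v (p m))) =
  \sum_m b m * c m.
Proof.
have am m m' : admissible k (fun v => v (p m) * v (p m')).
  by apply: admissibleM; exact: sq_admissible_coord.
transitivity (gaussE k (fun v => \sum_m \sum_m' (b m * c m') * (v (p m) * v (p m')))).
  congr gaussE; apply/funext => v; rewrite mulr_suml; apply: eq_bigr => m _.
  by rewrite mulr_sumr; apply: eq_bigr => m' _; rewrite mulrACA.
rewrite gaussE_sum => [|m]; last first.
  by apply: admissible_sum => m'; exact: admissibleZ.
apply: eq_bigr => m _; rewrite gaussE_sum => [|m']; last exact: admissibleZ.
rewrite (bigD1 m)//= big1 ?addr0 => [|m' mm'].
  by rewrite gaussEZ// gaussE_coordM// eqxx mulr1.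
by rewrite gaussEZ// gaussE_coordM// (inj_eq p_inj) eq_sym (negbTE mm') mulr0.
Qed.

Lemma measurable_norm_lt (s : R) : measurable [set y : R | `|y| < s].
Proof.
rewrite (_ : [set y : R | `|y| < s] = `]- s, s[%classic); first exact: measurable_itv.
by apply/seteqP; split => y /=; rewrite in_itv/= ltr_norml.
Qed.

Lemma admissible_small_ball b (s : R) :
  admissible k (fun v => \1_[set y : R | `|y| < s] (\sum_m b m * v (p m))).
Proof.
apply: (@admissible_bounded _ _ 1 0) => [d T z mz|v].
  apply: measurableT_comp; first by apply: measurable_indic; exact: measurable_norm_lt.
  exact: (sq_admissible_linear b).1.
by rewrite mul0r addr0 ger0_norm// indicE lern1 leq_b1.
Qed.

(* Anti-concentration: conditionally on the other coordinates, the form is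
   affine in the coordinate [p m0], whose law has a bounded density. *)
Lemma gaussE_small_ball b (s : R) m0 : 0 < s -> b m0 != 0 ->
  gaussE k (fun v => \1_[set y : R | `|y| < s] (\sum_m b m * v (p m))) <=
  normal_peak 1 * (2 * s / `|b m0|).
Proof.
move=> s0 b0; have af := admissible_small_ball b s.
rewrite -lee_fin -stdGaussE_fin//.
have [d [T [P [Z [PZ E]]]]] := @stdGaussE_repr R k.
rewrite (E _ af.1 af.2) (PZ.2 (p m0) _ (pk m0) af.1)//.
set K := normal_peak _ * _.
have inner t : (\int[gauss]_x (\1_[set y : R | `|y| < s]
    (\sum_m b m * upd (Z t) (p m0) x (p m)))%:E <= K%:E)%E.
  pose c := \sum_(m | m != m0) b m * Z t (p m).
  apply: le_trans (std_normal_itv_le c s0 b0).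
  have mA : measurable [set x : R | `|c + b m0 * x| < s].
    have mg : measurable_fun [set: R] (fun x : R => c + b m0 * x).
      apply: measurable_funD => //; exact: measurable_funM.
    have := mg measurableT _ (measurable_norm_lt s).
    by rewrite setTI.
  apply: (@le_trans _ _ (\int[gauss]_x
      (\1_[set x : R | `|c + b m0 * x| < s] x)%:E)%E); last first.
    by rewrite integral_indic// setIT.
  apply: ge0_le_integral => //.
  - apply/measurable_EFinP.
    apply: (af.1 _ _ (fun x : R => upd (Z t) (p m0) x)) => i; rewrite /upd.
    by case: eqP => _; [exact: measurable_id|exact: measurable_cst].
  - exact/measurable_EFinP/measurable_indic.
  - move=> x _; rewrite lee_fin (bigD1 m0)//= updd addrC.
    have -> : \sum_(m | m != m0) b m * upd (Z t) (p m0) x (p m) = c.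
      by apply: eq_bigr => m mm0; rewrite /upd (inj_eq p_inj) (negbTE mm0).
    by rewrite !indicE; exact: lexx.
rewrite -[leRHS](@probability_integral_cst _ _ _ P).
apply: ge0_le_integral => //.
- by move=> t _; apply: integral_ge0 => x _; rewrite lee_fin.
- apply: (@measurable_fun_fubini_tonelli_G _ _ (measurableTypeR R) T R gauss
    (fun xt => (\1_[set y : R | `|y| < s]
      (\sum_m b m * upd (Z xt.2) (p m0) xt.1 (p m)))%:E)).
  + apply/measurable_EFinP.
    apply: (af.1 _ _ (fun xt => upd (Z xt.2) (p m0) xt.1)) => i; rewrite /upd.
    case: eqP => _; first exact: measurable_fst.
    by apply: (measurableT_comp (PZ.1 i)); exact: measurable_snd.
  + by move=> xt; rewrite lee_fin.
Qed.

End linear_forms.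

End gauss_expectation.

(** * Positive semidefinite matrices *)

Section positive_semidefinite.
Context {R : realType}.

Section dot_product.
Variable n : nat.
Implicit Types (u v w : 'cV[R]_n) (N S : 'M[R]_n).

Definition dot u v : R := \sum_i u i 0 * v i 0.

Lemma dotE u v : dot u v = (u^T *m v) 0 0.
Proof. by rewrite mxE; apply: eq_bigr => i _; rewrite mxE. Qed.

Lemma dotC u v : dot u v = dot v u.
Proof. by apply: eq_bigr => i _; rewrite mulrC. Qed.

Lemma dotDr u v w : dot u (v + w) = dot u v + dot u w.
Proof. by rewrite !dotE mulmxDr mxE. Qed.

Lemma dotNr u v : dot u (- v) = - dot u v.
Proof. by rewrite !dotE mulmxN mxE. Qed.

Lemma dotZr a u v : dot u (a *: v) = a * dot u v.
Proof. by rewrite !dotE -scalemxAr mxE. Qed.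

Lemma dotDl u v w : dot (u + v) w = dot u w + dot v w.
Proof. by rewrite dotC dotDr !(dotC w). Qed.

Lemma dotNl u v : dot (- u) v = - dot u v.
Proof. by rewrite dotC dotNr dotC. Qed.

Lemma dotZl a u v : dot (a *: u) v = a * dot u v.
Proof. by rewrite dotC dotZr dotC. Qed.

Lemma dot_mulmxl N u v : dot (N *m u) v = dot u (N^T *m v).
Proof. by rewrite !dotE trmx_mul mulmxA. Qed.

Lemma dot_ge0 u : 0 <= dot u u.
Proof. by apply: sumr_ge0 => i _; rewrite -expr2 sqr_ge0. Qed.

Lemma dot_deltal i v : dot (delta_mx i 0) v = v i 0.
Proof.
rewrite /dot (bigD1 i)//= !mxE !eqxx mul1r big1 ?addr0// => j ji.
by rewrite !mxE (negbTE ji) mul0r.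
Qed.

Lemma mulmx_delta N i j : (N *m delta_mx j 0 : 'cV_n) i 0 = N i j.
Proof. by rewrite -colE mxE. Qed.

Definition psd S : Prop := S^T = S /\ forall v, 0 <= dot v (S *m v).

Lemma psd_sym S u v : psd S -> dot u (S *m v) = dot v (S *m u).
Proof. by move=> [St _]; rewrite dotC dot_mulmxl St. Qed.

Lemma psd_diag_ge0 S i : psd S -> 0 <= S i i.
Proof.
by move=> [_ /(_ (delta_mx i 0))]; rewrite dot_deltal mulmx_delta.
Qed.

Lemma psd_diag0 S i j : psd S -> S i i = 0 -> S i j = 0.
Proof.
move=> pS Sii; have [//|Sij0] := eqVneq (S i j) 0.
(* As [S i i = 0], the form at [t e_i + e_j] is [2 t S i j + S j j]; this [t] makes it equal to
   -1. *)
pose t := - (S j j + 1) / (2 * S i j).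
have := pS.2 (t *: delta_mx i 0 + delta_mx j 0).
rewrite mulmxDr -scalemxAr !(dotDl, dotDr, dotZl, dotZr).
rewrite [dot (delta_mx j 0) (S *m delta_mx i 0)](psd_sym _ _ pS).
rewrite !dot_deltal !mulmx_delta Sii.
have -> : t * (t * 0) + t * S i j + (t * S i j + S j j) = -1.
  by rewrite /t; field.
lra.
Qed.

(* One step of the Cholesky decomposition: the Schur complement. *)
Lemma psd_schur S i (b := (Num.sqrt (S i i))^-1 *: col i S) :
  psd S -> S i i != 0 -> psd (S - b *m b^T).
Proof.
move=> pS Sii0; have Sii : 0 < S i i by rewrite lt0r Sii0 psd_diag_ge0.
split; first by rewrite linearB/= trmx_mul trmxK pS.1.
move=> v; rewrite mulmxBl dotDr dotNr -mulmxA.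
pose c := dot (delta_mx i 0) (S *m v).
have bv : b^T *m v = ((Num.sqrt (S i i))^-1 * c)%:M.
  apply/matrixP => x y; rewrite !ord1 -dotE dotZl mxE mulr1n; congr (_ * _).
  by rewrite colE dot_mulmxl pS.1.
have -> : dot v (b *m (b^T *m v)) = c ^+ 2 / S i i.
  rewrite bv mul_mx_scalar dotZr dotC dotE bv mxE mulr1n mulrACA -invfM.
  by rewrite -expr2 sqr_sqrtr ?ltW// mulrC -expr2.
(* Completing the square: this shift of [v] minimizes the form along [e_i], with minimum
   [dot v (S *m v) - c^2 / S i i]. *)
have := pS.2 (v - (c / S i i) *: delta_mx i 0).
rewrite mulmxBr -scalemxAr !(dotDl, dotDr, dotNl, dotNr, dotZl, dotZr).
rewrite [dot v (S *m delta_mx i 0)](psd_sym _ _ pS) -/c.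
rewrite dot_deltal mulmx_delta.
by rewrite divfK// expr2 (mulrAC c c); lra.
Qed.

(** Cholesky decomposition from the last index down: [k] bounds the indices whose diagonal entry may
    be nonzero. A Schur step at index [k] clears that entry and leaves the later zeros alone,
    because a zero diagonal entry forces its whole row to vanish. *)
Lemma psd_factor S : psd S -> exists B : 'M[R]_n, B *m B^T = S.
Proof.
suff H (k : nat) : forall S, psd S -> (forall i : 'I_n, (k <= i)%N -> S i i = 0) ->
    exists b : nat -> 'cV[R]_n, S = \sum_(m < k) b m *m (b m)^T.
  move=> pS; have [|b ->] := H n S pS.
    by move=> i; rewrite leqNgt ltn_ord.
  exists (\matrix_(i, m) b m i 0); apply/matrixP => i j.
  rewrite summxE mxE; apply: eq_bigr => m _.
  by rewrite !mxE big_ord1 !mxE.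
elim: k => [|k IH] {}S pS S0.
  exists (fun=> 0); rewrite big_ord0; apply/matrixP => i j.
  by rewrite mxE (psd_diag0 _ pS)// S0.
have drop : (forall i : 'I_n, (k <= i)%N -> S i i = 0) ->
    exists b : nat -> 'cV[R]_n, S = \sum_(m < k.+1) b m *m (b m)^T.
  (* The entry at index [k] is already zero, so the decomposition is padded with a zero column. *)
  move=> /(IH _ pS)[b Sb]; exists (fun m => if (m < k)%N then b m else 0).
  rewrite big_ord_recr/= ltnn mul0mx addr0 Sb.
  by apply: eq_bigr => m _; rewrite ltn_ord.
have [kn|nk] := ltnP k n; last first.
  by apply: drop => i ki; have := leq_trans (leq_ltn_trans ki (ltn_ord i)) nk; rewrite ltnn.
pose i0 := Ordinal kn.
have [Si0|Si0] := eqVneq (S i0 i0) 0.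
  apply: drop => i; rewrite leq_eqVlt => /predU1P[ki|/S0//].
  by rewrite (_ : i = i0)//; apply: val_inj.
pose b0 := (Num.sqrt (S i0 i0))^-1 *: col i0 S.
have Sii : 0 < S i0 i0 by rewrite lt0r Si0 psd_diag_ge0.
have pS' := psd_schur pS Si0; rewrite -/b0 in pS'.
have [i|b Sb] := IH _ pS'.
  have -> : (S - b0 *m b0^T) i i = S i i - b0 i 0 ^+ 2.
    by rewrite !mxE big_ord1 !mxE expr2.
  rewrite !mxE leq_eqVlt => /predU1P[ki|ki].
    rewrite (_ : i = i0); last exact: val_inj.
    rewrite exprMn exprVn sqr_sqrtr ?ltW// expr2 mulrA mulVf// mul1r subrr//.
  by rewrite (psd_diag0 i0 pS (S0 i ki)) mulr0 expr0n/= S0// subr0.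
exists (fun m => if (m < k)%N then b m else b0).
rewrite big_ord_recr/= ltnn -(subrK (b0 *m b0^T) S) {1}Sb; congr (_ + _).
by apply: eq_bigr => m _; rewrite ltn_ord.
Qed.

(** [xget] returns its default 0 when there is no factor; existence rules this out. *)
Lemma covfactorP S : psd S -> covfactor S *m (covfactor S)^T = S.
Proof.
by move=> /psd_factor exB; have := @xgetPex _ 0 [set B : 'M[R]_n | B *m B^T = S] exB.
Qed.

Lemma mxtrace_quad m N (B : 'M[R]_(n, m)) :
  \tr (B^T *m N *m B) = \sum_j dot (col j B) (N *m col j B).
Proof.
rewrite -mulmxA; apply: eq_bigr => j _.
have -> : N *m col j B = col j (N *m B) by rewrite !colE mulmxA.
by rewrite mxE; apply: eq_bigr => i _; rewrite !mxE.
Qed.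

Lemma mxtrace_mul_gram m N (B : 'M[R]_(n, m)) :
  \tr (N *m (B *m B^T)) = \sum_j dot (col j B) (N *m col j B).
Proof.
by rewrite -mxtrace_quad mulmxA mxtrace_mulC mulmxA.
Qed.

Lemma psd_gram m (B : 'M[R]_(n, m)) : psd (B *m B^T).
Proof.
split; first by rewrite trmx_mul trmxK.
move=> v; rewrite dotE -mulmxA mulmxA mxE sumr_ge0// => i _.
rewrite (_ : (B^T *m v) i 0 = (v^T *m B) 0 i) -?expr2 ?sqr_ge0//.
by rewrite -[in RHS](trmxK B) -trmx_mul [RHS]mxE.
Qed.

Lemma psd_congr S N : psd S -> N^T = N -> psd (N *m S *m N).
Proof.
move=> [St S0] Nt; split; first by rewrite !trmx_mul St Nt mulmxA.
by move=> v; rewrite -!mulmxA dotC dot_mulmxl Nt dotC.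
Qed.

Lemma psdZ a S : 0 <= a -> psd S -> psd (a *: S).
Proof.
move=> a0 [St S0]; split; first by rewrite linearZ/= St.
by move=> v; rewrite -scalemxAl dotZr mulr_ge0.
Qed.

(** With [S = B B^T], both traces become sums of quadratic forms over the columns of [B], which are
    compared one by one. *)
Lemma le_mxtrace_mul N1 N2 S : psd S ->
  (forall v, dot v (N1 *m v) <= dot v (N2 *m v)) ->
  \tr (N1 *m S) <= \tr (N2 *m S).
Proof.
move=> /psd_factor[B <-] N12; rewrite !mxtrace_mul_gram.
exact: ler_sum.
Qed.

Lemma psd_mxtrace_ge0 S : psd S -> 0 <= \tr S.
Proof. by move=> pS; apply: sumr_ge0 => i _; exact: psd_diag_ge0. Qed.

End dot_product.
End positive_semidefinite.

(** * The normalized adjacency matrix *)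

Section normalized_adjacency.
Context {R : realType}.
Variables (n : nat) (e : rel 'I_n).
Hypothesis e_sym : forall i j, e i j = e j i.
Local Notation A := (Ahat R e).
Local Notation s i := ((Num.sqrt (1 + deg R e i))^-1).
Implicit Types u v : 'cV[R]_n.

Lemma deg_ge0 i : 0 <= deg R e i.
Proof. by apply: sumr_ge0 => j _; rewrite mxE ler0n. Qed.

Lemma deg_le i : deg R e i <= n%:R.
Proof.
apply: (@le_trans _ _ (\sum_(j < n) 1)); last by rewrite sumr_const card_ord.
by apply: ler_sum => j _; rewrite mxE lern1 leq_b1.
Qed.

Lemma AhatE i j : A i j = s i * ((e i j)%:R + (i == j)%:R) * s j.
Proof.
rewrite mxE (bigD1 j)//= big1 ?addr0; last first.
  by move=> k kj; rewrite [Dtinvsqrt _ _ _ _]mxE (negbTE kj) mulr0.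
rewrite [Dtinvsqrt _ _ _ _]mxE eqxx; congr (_ * _).
rewrite mxE (bigD1 i)//= big1 ?addr0; last first.
  by move=> k ki; rewrite [Dtinvsqrt _ _ _ _]mxE eq_sym (negbTE ki) mul0r.
by rewrite [Dtinvsqrt _ _ _ _]mxE eqxx !mxE.
Qed.

Lemma trmx_Ahat : A^T = A.
Proof.
by apply/matrixP => i j; rewrite mxE !AhatE (e_sym j i) (eq_sym j i); ring.
Qed.

(** In these coordinates [dot v v] and [dot v (A *m v)] are sums over edges plus the same self-loop
    term, the sum of [x v i ^+ 2]. *)
Let x v i := s i * v i 0.

Let degx v i : v i 0 ^+ 2 = (1 + deg R e i) * x v i ^+ 2.
Proof.
have d0 : 0 < 1 + deg R e i by rewrite ltr_pwDl// deg_ge0.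
by rewrite /x exprMn exprVn sqr_sqrtr ?ltW// mulrA mulfV ?gt_eqF// mul1r.
Qed.

Let dot_vv v : dot v v = \sum_i \sum_j (e i j)%:R * x v i ^+ 2 + \sum_i x v i ^+ 2.
Proof.
rewrite -big_split/=; apply: eq_bigr => i _.
rewrite -expr2 degx mulrDl mul1r addrC; congr (_ + _).
by rewrite /deg mulr_suml; apply: eq_bigr => j _; rewrite mxE.
Qed.

Let dot_vAv v : dot v (A *m v) =
  \sum_i \sum_j (e i j)%:R * (x v i * x v j) + \sum_i x v i ^+ 2.
Proof.
rewrite -big_split/=; apply: eq_bigr => i _.
rewrite mxE mulr_sumr.
have -> : x v i ^+ 2 = \sum_j (i == j)%:R * (x v i * x v j).
  rewrite (bigD1 i)//= eqxx mul1r big1 ?addr0// => j ji.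
  by rewrite eq_sym (negbTE ji) mul0r.
rewrite -big_split/=; apply: eq_bigr => j _; rewrite AhatE /x; ring.
Qed.

Let sum_sym v : \sum_i \sum_j (e i j)%:R * x v i ^+ 2 =
  \sum_i \sum_j (e i j)%:R * x v j ^+ 2.
Proof.
rewrite exchange_big/=; apply: eq_bigr => i _; apply: eq_bigr => j _.
by rewrite e_sym.
Qed.

(** For [c = -1] this is twice [dot v v - dot v (A *m v)]; for [c = 1] it is twice
    [dot v v + dot v (A *m v)] less four times the self-loop term. *)
Let sum_edges v (c : R) : \sum_i \sum_j (e i j)%:R * (x v i + c * x v j) ^+ 2 =
  (1 + c ^+ 2) * \sum_i \sum_j (e i j)%:R * x v i ^+ 2 +
  2 * c * \sum_i \sum_j (e i j)%:R * (x v i * x v j).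
Proof.
rewrite mulrDl mul1r {2}sum_sym !mulr_sumr -!big_split/=; apply: eq_bigr => i _.
rewrite !mulr_sumr -!big_split/=; apply: eq_bigr => j _; ring.
Qed.

Let sum_edges_ge0 v (c : R) :
  0 <= \sum_i \sum_j (e i j)%:R * (x v i + c * x v j) ^+ 2.
Proof.
by apply: sumr_ge0 => i _; apply: sumr_ge0 => j _; rewrite mulr_ge0 ?sqr_ge0.
Qed.

Lemma dot_Ahat_le v : dot v (A *m v) <= dot v v.
Proof.
by rewrite dot_vv dot_vAv; have := sum_edges_ge0 v (-1); rewrite sum_edges; lra.
Qed.

(* The self-loops keep the spectrum of [A] away from -1. *)
Lemma dot_Ahat_ge v : dot v v <= n.+1%:R / 2 * (dot v v + dot v (A *m v)).
Proof.
(* The factor [n + 1] bounds [1 + deg]; the self-loop term is then at most half of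
   [dot v v + dot v (A *m v)]. *)
have h : dot v v <= n.+1%:R * \sum_i x v i ^+ 2.
  rewrite mulr_sumr; apply: ler_sum => i _; rewrite -expr2 degx.
  by apply: ler_wpM2r; rewrite ?sqr_ge0// -natr1 addrC lerD2r deg_le.
apply: (le_trans h); rewrite -mulrA ler_wpM2l//.
rewrite dot_vv dot_vAv.
by have := sum_edges_ge0 v 1; rewrite sum_edges; lra.
Qed.

(** With [r] standing for an eigenvalue of [A], the three conclusions read [r <= 1],
    [(1 - r)(1 + r)^2 >= 0] and [(1 - r)^2 <= (n + 1)/2 * (1 - r)^2 (1 + r)]. The last two are the
    bounds above, applied to [v + A v] and to [v - A v]. *)
Let moments v :
  let m0 := dot v v in let m1 := dot v (A *m v) in
  let m2 := dot (A *m v) (A *m v) in let m3 := dot (A *m v) (A *m (A *m v)) in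
  [/\ m1 <= m0, 0 <= m0 + m1 - m2 - m3 &
      m0 - 2 * m1 + m2 <= n.+1%:R / 2 * (m0 - m1 - m2 + m3)].
Proof.
set w := A *m v; move=> m0 m1 m2 m3.
have e2 : dot v (A *m w) = m2 by rewrite dotC dot_mulmxl trmx_Ahat.
have e1 : dot w v = m1 by rewrite dotC.
have := dot_Ahat_le v; have := dot_Ahat_le (v + w); have := dot_Ahat_ge (v - w).
rewrite mulmxBr mulmxDr -/w !(dotDl, dotDr, dotNl, dotNr) e1 e2 -/m0 -/m1 -/m2 -/m3.
move=> h1 h2 h3; split=> //; first by lra.
lra.
Qed.

(** In the same notation, [2 (1 - r^2)] is the sum of [(1 - r)(1 + r)^2] and [(1 - r)^2 (1 + r)],
    both nonnegative by [moments]. *)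
Lemma dot_Ahat2_le v : dot (A *m v) (A *m v) <= dot v v.
Proof.
have [h1 h2 h3] := moments v.
have h : 0 <= dot v v - 2 * dot v (A *m v) + dot (A *m v) (A *m v).
  have := dot_ge0 (v - A *m v).
  by rewrite !(dotDl, dotDr, dotNl, dotNr) (dotC (A *m v) v); lra.
have {h h3} := le_trans h h3.
by rewrite pmulr_rge0 ?divr_gt0//; lra.
Qed.

(* With P = I - A and Q = I + A one has I - A^2 = (PQP + QPQ) / 2, while
   A = (Q - P) / 2 gives APA <= (QPQ + PPP) / 2 by the parallelogram identity,
   and PPP <= 2 P^2 <= (n + 1) PQP. *)
Lemma dot_Ahat_Lhat_le v :
  dot (A *m v) (Lhat R e *m (A *m v)) <=
  n.+1%:R * (dot v v - dot (A *m v) (A *m v)).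
Proof.
rewrite /Lhat mulmxBl mul1mx dotDr dotNr.
have [] := moments v.
set m0 := dot v v; set m1 := dot v (A *m v); set m2 := dot (A *m v) (A *m v).
set m3 := dot (A *m v) _ => h1 h2 h3.
have n1 : (1 : R) <= n.+1%:R by rewrite ler1n.
have : 0 <= (n.+1%:R - 1) * (m0 + m1 - m2 - m3) by rewrite mulr_ge0// subr_ge0.
have : 0 <= m0 - 2 * m1 + m2.
  have := dot_ge0 (v - A *m v).
  by rewrite !(dotDl, dotDr, dotNl, dotNr) (dotC (A *m v) v) -/m0 -/m1 -/m2; lra.
by nra.
Qed.

Lemma dot_Lhat_ge0 v : 0 <= dot v (Lhat R e *m v).
Proof. by rewrite /Lhat mulmxBl mul1mx dotDr dotNr subr_ge0 dot_Ahat_le. Qed.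

Lemma dot_Lhat_le v : dot v (Lhat R e *m v) <= 2 * dot v v.
Proof.
rewrite /Lhat mulmxBl mul1mx dotDr dotNr.
have := le_trans (dot_ge0 v) (dot_Ahat_ge v).
by rewrite pmulr_rge0 ?divr_gt0//; lra.
Qed.

End normalized_adjacency.

(** * Gaussian matrices and the ReLU covariance *)

Section gaussian_matrix.
Context {R : realType}.
Variables (n C : nat) (S : 'M[R]_n).
Hypothesis pS : psd S.
Local Notation B := (covfactor S).
Local Notation H z := (B *m zmat n C z).
Implicit Types (u w : 'cV[R]_n) (j : 'I_C).

Definition col_index j (m : 'I_n) : nat := (m + n * j)%N.

Lemma col_index_inj j : injective (col_index j).
Proof. by move=> m m' /addIn /val_inj. Qed.

Lemma col_index_lt j m : (col_index j m < n * C)%N.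
Proof.
apply: (@leq_trans (n + n * j)); first by rewrite /col_index ltn_add2r.
by rewrite -mulnS leq_mul2l ltn_ord orbT.
Qed.

Lemma dot_col_linear u j z :
  dot u (col j (H z)) = \sum_m (B^T *m u) m 0 * z (col_index j m).
Proof.
have -> : col j (H z) = B *m col j (zmat n C z) by rewrite !colE mulmxA.
rewrite dotC dot_mulmxl dotC; apply: eq_bigr => m _.
by rewrite !mxE.
Qed.

Lemma sq_admissible_dot_col u j :
  sq_admissible (n * C) (fun z => dot u (col j (H z))).
Proof.
rewrite (_ : (fun z => _) =
    (fun z => \sum_m (B^T *m u) m 0 * z (col_index j m))); last first.
  by apply/funext => z; exact: dot_col_linear.
by apply: sq_admissible_linear => m; exact: col_index_lt.
Qed.

Lemma gaussE_dot_col u w j :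
  gaussE (n * C) (fun z => dot u (col j (H z)) * dot w (col j (H z))) =
  dot u (S *m w).
Proof.
rewrite (_ : (fun z => _) = (fun z =>
    (\sum_m (B^T *m u) m 0 * z (col_index j m)) *
    (\sum_m (B^T *m w) m 0 * z (col_index j m)))); last first.
  by apply/funext => z; rewrite !dot_col_linear.
rewrite gaussE_linearM; last 2 first.
- exact: col_index_inj.
- by move=> m; exact: col_index_lt.
rewrite -/(dot (B^T *m u) (B^T *m w)) dot_mulmxl trmxK mulmxA.
by rewrite covfactorP.
Qed.

(** Splits a quadratic form into products of two linear forms, to which the covariance formula
    applies. *)
Let quad_sum (N : 'M[R]_n) (h : 'cV[R]_n) :
  dot h (N *m h) = \sum_i dot (delta_mx i 0) h * dot (N^T *m delta_mx i 0) h.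
Proof.
by apply: eq_bigr => i _; rewrite dot_mulmxl trmxK !dot_deltal.
Qed.

Lemma admissible_quad (N : 'M[R]_n) : admissible (n * C)
  (fun z => \sum_j dot (col j (H z)) (N *m col j (H z))).
Proof.
apply: admissible_sum => j.
rewrite (_ : (fun z => _) = (fun z => \sum_i dot (delta_mx i 0) (col j (H z)) *
    dot (N^T *m delta_mx i 0) (col j (H z)))); last first.
  by apply/funext => z; exact: quad_sum.
by apply: admissible_sum => i; apply: admissibleM; exact: sq_admissible_dot_col.
Qed.

Lemma gaussE_quad (N : 'M[R]_n) :
  gaussE (n * C) (fun z => \sum_j dot (col j (H z)) (N *m col j (H z))) =
  C%:R * \tr (N *m S).
Proof.
have aij j i : admissible (n * C) (fun z => dot (delta_mx i 0) (col j (H z)) *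
    dot (N^T *m delta_mx i 0) (col j (H z))).
  by apply: admissibleM; exact: sq_admissible_dot_col.
rewrite (_ : (fun z => _) = (fun z => \sum_j \sum_i
    dot (delta_mx i 0) (col j (H z)) *
    dot (N^T *m delta_mx i 0) (col j (H z)))); last first.
  by apply/funext => z; apply: eq_bigr => j _; exact: quad_sum.
rewrite gaussE_sum => [|j]; last exact: admissible_sum.
rewrite (eq_bigr (fun=> \tr (N *m S))) ?sumr_const ?card_ord ?mulr_natl// => j _.
rewrite gaussE_sum// -mxtrace_tr.
apply: eq_bigr => i _; rewrite gaussE_dot_col dot_deltal mulmxA mulmx_delta.
by rewrite trmx_mul pS.1.
Qed.

End gaussian_matrix.

(** * Frobenius norm and Dirichlet energy as sums over columns *)

Section quadratic_statistics.
Context {R : realType}.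

Lemma frob2_dot n C (H : 'M[R]_(n, C)) :
  frob2 H = \sum_j dot (col j H) (1%:M *m col j H).
Proof.
rewrite /frob2 exchange_big/=; apply: eq_bigr => j _; rewrite mul1mx.
by apply: eq_bigr => i _; rewrite !mxE expr2.
Qed.

Lemma frob2_ge0 n C (H : 'M[R]_(n, C)) : 0 <= frob2 H.
Proof. by apply: sumr_ge0 => i _; apply: sumr_ge0 => j _; exact: sqr_ge0. Qed.

Lemma frob2_ge n C (H : 'M[R]_(n, C)) i j : H i j ^+ 2 <= frob2 H.
Proof.
rewrite /frob2 (bigD1 i)//= (bigD1 j)//= -addrA lerDl addr_ge0//.
  by apply: sumr_ge0 => j' _; exact: sqr_ge0.
by apply: sumr_ge0 => i' _; apply: sumr_ge0 => j' _; exact: sqr_ge0.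
Qed.

Lemma frob2_gt0 n C (H : 'M[R]_(n, C)) : H != 0 -> 0 < frob2 H.
Proof.
move=> /matrix0Pn[i [j Hij]]; apply: lt_le_trans (frob2_ge H i j).
by rewrite exprn_even_gt0.
Qed.

Lemma frob2_mxtrace n C (H : 'M[R]_(n, C)) : frob2 H = \tr (H *m H^T).
Proof.
apply: eq_bigr => i _; rewrite mxE; apply: eq_bigr => j _.
by rewrite mxE expr2.
Qed.

Lemma Dir_dot n C (e : rel 'I_n) (H : 'M[R]_(n, C)) :
  Dir e H = \sum_j dot (col j H) (Lhat R e *m col j H).
Proof. exact: mxtrace_quad. Qed.

End quadratic_statistics.

(** * Covariance of the activated Gaussian vector *)

Section relu_covariance.
Context {R : realType}.
Variables (alpha beta : R) (n : nat) (S : 'M[R]_n).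
Hypothesis pS : psd S.
Local Notation sigma := (abrelu alpha beta).
Local Notation c := ((alpha ^+ 2 + beta ^+ 2) / 2).
Local Notation h z i := ((covfactor S *m zmat n 1 z) i 0).

Lemma measurable_abrelu : measurable_fun [set: R] sigma.
Proof.
apply: measurable_fun_ifT.
- exact: measurable_fun_ler.
- exact: measurable_funM.
- exact: measurable_funM.
Qed.

Lemma abrelu_sqr_le (x : R) : sigma x ^+ 2 <= (alpha ^+ 2 + beta ^+ 2) * x ^+ 2.
Proof.
rewrite /abrelu mulrDl; case: ifP => _; rewrite exprMn.
  by rewrite lerDl mulr_ge0 ?sqr_ge0.
by rewrite lerDr mulr_ge0 ?sqr_ge0.
Qed.

Lemma abrelu_sqrDN (x : R) :
  sigma x ^+ 2 + sigma (- x) ^+ 2 = (alpha ^+ 2 + beta ^+ 2) * x ^+ 2.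
Proof.
rewrite /abrelu oppr_ge0; case: ltgtP => [x0|x0|<-].
- by rewrite !exprMn sqrrN; ring.
- by rewrite !exprMn sqrrN; ring.
- by rewrite oppr0; ring.
Qed.

Lemma entry_dot z i : h z i = dot (delta_mx i 0) (col 0 (covfactor S *m zmat n 1 z)).
Proof. by rewrite dot_deltal [RHS]mxE. Qed.

Lemma sq_admissible_entry i : sq_admissible (n * 1) (fun z => h z i).
Proof.
rewrite (_ : (fun z => _) = (fun z =>
    dot (delta_mx i 0) (col 0 (covfactor S *m zmat n 1 z)))).
  exact: sq_admissible_dot_col.
by apply/funext => z; exact: entry_dot.
Qed.

Lemma sq_admissible_abrelu_entry i :
  sq_admissible (n * 1) (fun z => sigma (h z i)).
Proof.
apply: (sq_admissible_le _ (sq_admissible_entry i)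
  (fun z => abrelu_sqr_le (h z i))).
move=> d T z mz; apply: (measurableT_comp measurable_abrelu).
exact: (sq_admissible_entry i).1.
Qed.

Lemma GmxE i j :
  Gmx sigma S i j = gaussE (n * 1) (fun z => sigma (h z i) * sigma (h z j)).
Proof. by rewrite mxE. Qed.

(** The quadratic form at [v] is the mean of the square of [\sum_i v i 0 * sigma (h z i)]. *)
Lemma psd_Gmx : psd (Gmx sigma S).
Proof.
split.
  apply/matrixP => i j; rewrite mxE !GmxE; congr gaussE; apply/funext => z.
  by rewrite mulrC.
move=> v.
have aij i j : admissible (n * 1) (fun z => sigma (h z i) * sigma (h z j)).
  by apply: admissibleM; exact: sq_admissible_abrelu_entry.
have -> : dot v (Gmx sigma S *m v) = gaussE (n * 1) (fun z =>
    \sum_i \sum_j (v i 0 * v j 0) * (sigma (h z i) * sigma (h z j))).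
  rewrite gaussE_sum => [|i]; last by apply: admissible_sum => j; exact: admissibleZ.
  apply: eq_bigr => i _; rewrite gaussE_sum => [|j]; last exact: admissibleZ.
  rewrite mxE mulr_sumr; apply: eq_bigr => j _.
  by rewrite gaussEZ// -GmxE; ring.
apply: gaussE_ge0.
  by apply: admissible_sum => i; apply: admissible_sum => j; exact: admissibleZ.
move=> z; have -> : \sum_i \sum_j (v i 0 * v j 0) * (sigma (h z i) * sigma (h z j)) =
    (\sum_i v i 0 * sigma (h z i)) ^+ 2.
  rewrite expr2 mulr_suml; apply: eq_bigr => i _.
  by rewrite mulr_sumr; apply: eq_bigr => j _; ring.
exact: sqr_ge0.
Qed.

Lemma mxtrace_Gmx : \tr (Gmx sigma S) = c * \tr S.
Proof.
rewrite /mxtrace mulr_sumr; apply: eq_bigr => i _; rewrite GmxE.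
have as2 := sq_admissible_sqr (sq_admissible_abrelu_entry i).
have ah2 := sq_admissible_sqr (sq_admissible_entry i).
(* [zmat n 1] reads only coordinates below [n * 1], so flipping those negates the whole vector. *)
have hN z : h (neg_below (n * 1) z) i = - h z i.
  rewrite !mxE -sumrN; apply: eq_bigr => m _; rewrite !mxE -mulrN; congr (_ * _).
  rewrite /neg_below ifT//; exact: (@col_index_lt n 1 ord0 m).
have asN : admissible (n * 1) (fun z => sigma (- h z i) ^+ 2).
  apply: sq_admissible_sqr; apply: (sq_admissible_le _ (sq_admissible_entry i)
    (c := alpha ^+ 2 + beta ^+ 2)).
    move=> d T z mz; apply: (measurableT_comp measurable_abrelu).
    by apply: measurableT_comp => //; exact: (sq_admissible_entry i).1.
  by move=> z; rewrite -[h z i ^+ 2]sqrrN abrelu_sqr_le.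
have EN : gaussE (n * 1) (fun z => sigma (- h z i) ^+ 2) =
    gaussE (n * 1) (fun z => sigma (h z i) ^+ 2).
  rewrite -[RHS](gaussE_neg as2) => [|z]; last exact: sqr_ge0.
  by congr gaussE; apply/funext => z; rewrite hN.
have Eh : gaussE (n * 1) (fun z => h z i ^+ 2) = S i i.
  rewrite -(mulmx_delta S) -(dot_deltal i) -(gaussE_dot_col pS _ _ (ord0 : 'I_1)).
  by congr gaussE; apply/funext => z; rewrite entry_dot.
have := gaussED as2 asN; rewrite EN.
rewrite (_ : (fun z => _) = (fun z => (alpha ^+ 2 + beta ^+ 2) * h z i ^+ 2)).
  rewrite gaussEZ// Eh => E.
  have -> : (fun z => sigma (h z i) * sigma (h z i)) = (fun z => sigma (h z i) ^+ 2).
    by apply/funext => z; rewrite expr2.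
  lra.
by apply/funext => z; exact: abrelu_sqrDN.
Qed.

End relu_covariance.

(** * Dirichlet energy along the layers *)

Section dirichlet_ratio.
Context {R : realType}.
Variables (n C : nat) (e : rel 'I_n).
Hypotheses (e_sym : forall i j, e i j = e j i) (C0 : (0 < C)%N).
Variable (S : 'M[R]_n).
Hypothesis pS : psd S.
Local Notation H z := (covfactor S *m zmat n C z).

Lemma Dir_ge0 (K : 'M[R]_(n, C)) : 0 <= Dir e K.
Proof. by rewrite Dir_dot sumr_ge0// => j _; exact: dot_Lhat_ge0. Qed.

Lemma Dir_le (K : 'M[R]_(n, C)) : Dir e K <= 2 * frob2 K.
Proof.
rewrite Dir_dot frob2_dot mulr_sumr; apply: ler_sum => j _.
by rewrite mul1mx; exact: dot_Lhat_le.
Qed.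

Lemma Dir_ratio_ge0 (K : 'M[R]_(n, C)) : 0 <= Dir e K / frob2 K.
Proof. by rewrite divr_ge0 ?Dir_ge0 ?frob2_ge0. Qed.

Lemma Dir_ratio_le2 (K : 'M[R]_(n, C)) : Dir e K / frob2 K <= 2.
Proof.
(* At a zero denominator the quotient is 0 by the convention on inverses. *)
have [->|K0] := eqVneq (frob2 K) 0; first by rewrite invr0 mulr0.
by rewrite ler_pdivrMr ?Dir_le// lt0r K0 frob2_ge0.
Qed.

Lemma admissible_frob2 : admissible (n * C) (fun z => frob2 (H z)).
Proof.
rewrite (_ : (fun z => _) =
    (fun z => \sum_j dot (col j (H z)) (1%:M *m col j (H z)))).
  exact: admissible_quad.
by apply/funext => z; exact: frob2_dot.
Qed.

Lemma gaussE_frob2 : gaussE (n * C) (fun z => frob2 (H z)) = C%:R * \tr S.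
Proof.
rewrite (_ : (fun z => _) =
    (fun z => \sum_j dot (col j (H z)) (1%:M *m col j (H z)))).
  by rewrite gaussE_quad// mul1mx.
by apply/funext => z; exact: frob2_dot.
Qed.

Lemma admissible_Dir : admissible (n * C) (fun z => Dir e (H z)).
Proof.
rewrite (_ : (fun z => _) =
    (fun z => \sum_j dot (col j (H z)) (Lhat R e *m col j (H z)))).
  exact: admissible_quad.
by apply/funext => z; exact: Dir_dot.
Qed.

Lemma gaussE_Dir :
  gaussE (n * C) (fun z => Dir e (H z)) = C%:R * \tr (Lhat R e *m S).
Proof.
rewrite (_ : (fun z => _) =
    (fun z => \sum_j dot (col j (H z)) (Lhat R e *m col j (H z)))).
  by rewrite gaussE_quad.
by apply/funext => z; exact: Dir_dot.
Qed.

Lemma admissible_Dir_ratio :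
  admissible (n * C) (fun z => Dir e (H z) / frob2 (H z)).
Proof.
apply: (@admissible_bounded _ _ _ 2 0) => [d T z mz|z]; last first.
  by rewrite mul0r addr0 ger0_norm ?Dir_ratio_ge0 ?Dir_ratio_le2.
apply: measurable_funM; first exact: admissible_Dir.1.
(* The power -1 is a measurable function that agrees with the inverse on all nonnegative reals,
   including 0. *)
rewrite (_ : (fun t => (frob2 (H (z t)))^-1) =
    (fun t => frob2 (H (z t)) `^ (-1))).
  apply: (measurableT_comp (measurable_powR _)); exact: admissible_frob2.1.
by apply/funext => t; rewrite powR_inv1 ?frob2_ge0.
Qed.

(* On [frob2 H >= s^2] the ratio is at most [Dir H / s^2]; elsewhere it is at
   most 2 and a Gaussian linear form of variance bounded below is smaller than s. *)
Lemma gaussE_Dir_ratio_le (l s : R) : 0 < l -> l <= \tr S -> 0 < s ->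
  gaussE (n * C) (fun z => Dir e (H z) / frob2 (H z)) <=
  C%:R * \tr (Lhat R e *m S) / s ^+ 2 +
  4 * normal_peak 1 * n.+1%:R / Num.sqrt l * s.
Proof.
move=> l0 lS s0.
have sl0 : 0 < Num.sqrt l by rewrite sqrtr_gt0.
have n0 : (0 : R) < n.+1%:R by [].
(* Pigeonhole: the [n^2] squared entries of the factor add up to [\tr S >= l]. Dividing by
   [(n + 1)^2] keeps the bound meaningful for [n = 0] and the contradiction strict. *)
have [i [m Bim]] : exists i m, l / n.+1%:R ^+ 2 <= covfactor S i m ^+ 2.
  apply: contrapT => nB.
  have {}nB i m : covfactor S i m ^+ 2 < l / n.+1%:R ^+ 2.
    by rewrite ltNge; apply/negP => h; apply: nB; exists i, m.
  have : frob2 (covfactor S) <= \sum_(i < n) \sum_(j < n) l / n.+1%:R ^+ 2.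
    by apply: ler_sum => i _; apply: ler_sum => j _; exact: ltW.
  rewrite frob2_mxtrace covfactorP// sumr_const card_ord sumr_const card_ord.
  rewrite -mulrnA -[_ *+ _]mulr_natr natrM -expr2.
  move=> /(le_trans lS); rewrite mulrAC ler_pdivlMr ?exprn_gt0// ler_pM2l//.
  by rewrite -!natrX ler_nat leq_exp2r// ltnn.
have Bim0 : Num.sqrt l / n.+1%:R <= `|covfactor S i m|.
  rewrite -(ler_pXn2r (_ : (0 < 2)%N)) ?nnegrE ?divr_ge0 ?(ltW sl0)//.
  by rewrite exprMn exprVn (sqr_sqrtr (ltW l0)) real_normK ?num_real.
have aB0 : 0 < `|covfactor S i m| by apply: lt_le_trans Bim0; rewrite divr_gt0.
pose j0 := Ordinal C0.
(* This is the entry [(i, j0)] of [H], a linear form whose coefficient at [m] is the large entry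
   just found. *)
pose f z := \sum_m' covfactor S i m' * z (col_index j0 m').
have fE z : f z = H z i j0.
  by rewrite mxE; apply: eq_bigr => m' _; rewrite mxE.
have pinj : injective (@col_index n C j0) by exact: col_index_inj.
have plt (m' : 'I_n) : (col_index j0 m' < n * C)%N by exact: col_index_lt.
have aball := admissible_small_ball plt (fun m' => covfactor S i m') s.
have ball := gaussE_small_ball pinj plt (b := fun m' => covfactor S i m')
  s0 (m0 := m).
have {}ball := ball (_ : covfactor S i m != 0).
have {}ball : gaussE (n * C) (fun z => \1_[set y : R | `|y| < s] (f z)) <=
    normal_peak 1 * (2 * s / `|covfactor S i m|).
  by apply: ball; rewrite -normr_gt0.
apply: (@le_trans _ _ (gaussE (n * C) (fun z => (s ^+ 2)^-1 * Dir e (H z) +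
    2 * \1_[set y : R | `|y| < s] (f z)))).
  apply: le_gaussE.
  - exact: admissible_Dir_ratio.
  - apply: admissibleD; apply: admissibleZ => //; exact: admissible_Dir.
  move=> z; have [fs|fs] := ltP (`|f z|) s.
    rewrite indicE mem_set// mulr1; apply: (le_trans (Dir_ratio_le2 _)).
    by rewrite lerDr mulr_ge0 ?Dir_ge0// invr_ge0 sqr_ge0.
  apply: (@le_trans _ _ ((s ^+ 2)^-1 * Dir e (H z))); last first.
    by rewrite lerDl mulr_ge0.
  rewrite mulrC ler_wpM2r ?Dir_ge0//.
  have sH : s ^+ 2 <= frob2 (H z).
    apply: le_trans (frob2_ge (H z) i j0); rewrite -fE.
    by rewrite -[f z ^+ 2]real_normK ?num_real// ler_pXn2r ?nnegrE ?(ltW s0).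
  by rewrite lef_pV2// posrE ?exprn_gt0//; apply: lt_le_trans sH; rewrite exprn_gt0.
rewrite gaussED; last 2 first.
- by apply: admissibleZ; exact: admissible_Dir.
- by apply: admissibleZ.
rewrite gaussEZ; last exact: admissible_Dir.
rewrite gaussEZ// gaussE_Dir mulrC lerD2l.
apply: (@le_trans _ _ (2 * (normal_peak 1 * (2 * s / `|covfactor S i m|)))).
  by rewrite ler_wpM2l.
(* The 4 is the bound 2 on the ratio times the 2 in the interval length [2 * s]. *)
rewrite (_ : 4 * _ * _ / _ * _ = 2 * (normal_peak 1 * (2 * s * (n.+1%:R / Num.sqrt l)))).
  rewrite !ler_wpM2l ?normal_peak_ge0 ?mulr_ge0 ?(ltW s0)//.
  by rewrite -[leRHS]invrK lef_pV2 ?posrE// invf_div// divr_gt0.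
by ring.
Qed.

End dirichlet_ratio.

(** * Traces along the covariance sequence *)

Section covariance_sequence.
Context {R : realType}.
Variables (alpha beta : R) (n d0 : nat) (e : rel 'I_n).
Hypothesis e_sym : forall i j, e i j = e j i.
Variables (X : 'M[R]_(n, d0)) (sw2 : R).
Hypothesis sw0 : 0 < sw2.
Local Notation sigma := (abrelu alpha beta).
Local Notation c := ((alpha ^+ 2 + beta ^+ 2) / 2).
Local Notation A := (Ahat R e).
Local Notation Sig m := (iter m
  (fun S => sw2 *: (A *m Gmx sigma S *m A)) (Sigma1 e sw2 X)).

(** Needed for [covfactor] to be a true factor at every layer. Mind the shift: [Sig m] is the
    covariance of layer [m + 1]. *)
Lemma psd_Sigma m : psd (Sig m).
Proof.
elim: m => [|m IH] /=.
  rewrite /Sigma1 -(mulmxA A X); apply: psdZ; first by rewrite divr_ge0 ?(ltW sw0).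
  by apply: psd_congr; [exact: psd_gram|exact: trmx_Ahat].
apply: psdZ; first exact: ltW.
by apply: psd_congr; [exact: psd_Gmx|exact: trmx_Ahat].
Qed.

Lemma mxtrace_Ahat_congr_le (G : 'M[R]_n) : psd G -> \tr (A *m G *m A) <= \tr G.
Proof.
move=> pG; rewrite mxtrace_mulC mulmxA -[leRHS]/(\tr G) -{2}(mul1mx G).
apply: le_mxtrace_mul => // v.
by rewrite mul1mx -mulmxA dotC dot_mulmxl trmx_Ahat// dot_Ahat2_le.
Qed.

Lemma mxtrace_Sigma1_le : \tr (Sig 0) <= sw2 / d0%:R * frob2 X.
Proof.
rewrite /= /Sigma1 mxtraceZ ler_wpM2l ?divr_ge0 ?(ltW sw0)//.
by rewrite -(mulmxA A X) frob2_mxtrace mxtrace_Ahat_congr_le//; exact: psd_gram.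
Qed.

Lemma mxtrace_SigmaS_le m : \tr (Sig m.+1) <= sw2 * c * \tr (Sig m).
Proof.
rewrite /= mxtraceZ -mulrA ler_wpM2l ?(ltW sw0)//.
rewrite -mxtrace_Gmx; last exact: psd_Sigma.
by apply: mxtrace_Ahat_congr_le; apply: psd_Gmx; exact: psd_Sigma.
Qed.

Lemma mxtrace_Sigma_le m :
  \tr (Sig m) <= (sw2 * c) ^+ m * (sw2 / d0%:R * frob2 X).
Proof.
elim: m => [|m IH]; first by rewrite expr0 mul1r; exact: mxtrace_Sigma1_le.
apply: (le_trans (mxtrace_SigmaS_le m)); rewrite [_ ^+ m.+1]exprS -(mulrA (sw2 * c)).
apply: ler_wpM2l => //.
by rewrite mulr_ge0 ?(ltW sw0)// divr_ge0// addr_ge0 ?sqr_ge0.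
Qed.

(** At the critical variance the activation preserves the scaled trace, so with
    [G = Gmx sigma (Sig m)] the loss [\tr (Sig m) - \tr (Sig m.+1)] is [sw2 * \tr ((1 - A^2) G)].
    The left-hand side is [sw2 * \tr (A (1 - A) A G)], and the two are compared as forms in [A]. *)
Lemma mxtrace_Lhat_Sigma_le m : sw2 * c = 1 ->
  \tr (Lhat R e *m Sig m.+1) <= n.+1%:R * (\tr (Sig m) - \tr (Sig m.+1)).
Proof.
move=> sc1.
have tG : \tr (Sig m) = sw2 * \tr (Gmx sigma (Sig m)).
  rewrite mxtrace_Gmx; last exact: psd_Sigma.
  by rewrite mulrA sc1 mul1r.
rewrite tG [Sig m.+1]/=; set G := Gmx sigma _.
have pG : psd G by apply: psd_Gmx; exact: psd_Sigma.
rewrite -scalemxAr !mxtraceZ -mulrBr mulrCA ler_wpM2l ?(ltW sw0)//.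
have -> : \tr (Lhat R e *m (A *m G *m A)) = \tr (A *m Lhat R e *m A *m G).
  by rewrite mulmxA mxtrace_mulC !mulmxA.
have -> : n.+1%:R * (\tr G - \tr (A *m G *m A)) =
    \tr ((n.+1%:R *: (1%:M - A *m A)) *m G).
  rewrite -scalemxAl mxtraceZ; congr (_ * _).
  by rewrite mulmxBl mul1mx linearB/=; congr (_ - _); rewrite mxtrace_mulC mulmxA.
apply: le_mxtrace_mul => // v.
have -> : dot v (A *m Lhat R e *m A *m v) = dot (A *m v) (Lhat R e *m (A *m v)).
  by rewrite -(mulmxA _ A v) -(mulmxA A) dot_mulmxl trmx_Ahat.
apply: (le_trans (dot_Ahat_Lhat_le e_sym v)).
rewrite -scalemxAl dotZr mulmxBl mul1mx dotDr dotNr -(mulmxA A A v).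
by rewrite [dot (A *m v) _]dot_mulmxl trmx_Ahat.
Qed.

End covariance_sequence.

(** * Limits of the two metrics *)

Section metrics.
Context {R : realType}.
Variables (alpha beta : R) (n d0 C : nat) (e : rel 'I_n).
Hypothesis e_sym : forall i j, e i j = e j i.
Variables (X : 'M[R]_(n, d0)) (sw2 : R).
Hypotheses (sw0 : 0 < sw2) (C0 : (0 < C)%N).
Local Notation sigma := (abrelu alpha beta).
Local Notation c := ((alpha ^+ 2 + beta ^+ 2) / 2).
Local Notation Sig m := (iter m
  (fun S => sw2 *: (Ahat R e *m Gmx sigma S *m Ahat R e)) (Sigma1 e sw2 X)).

Lemma FSPE L :
  FSP sigma C e X sw2 L = (C%:R * \tr (Sig L.-1) / frob2 X)%:E.
Proof.
have pS := psd_Sigma alpha beta e_sym X sw0 L.-1.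
have aF := admissible_frob2 C (Sig L.-1).
rewrite /FSP /gaussMxE -/(Sigma_seq _ _ _ _ _) /Sigma_seq.
rewrite (_ : (fun z => _) = (fun z => ((frob2 X)^-1 *
    frob2 (covfactor (Sig L.-1) *m zmat n C z))%:E)); last first.
  by apply/funext => z; rewrite mulrC.
rewrite stdGaussE_fin; last exact: admissibleZ.
by rewrite gaussEZ// gaussE_frob2// mulrC.
Qed.

Lemma GEVE L : GEV sigma C e X sw2 L = (gaussE (n * C) (fun z =>
  Dir e (covfactor (Sig L.-1) *m zmat n C z) /
  frob2 (covfactor (Sig L.-1) *m zmat n C z)))%:E.
Proof.
by rewrite -stdGaussE_fin//; exact: admissible_Dir_ratio.
Qed.

Hypothesis sc1 : sw2 * c = 1.
Let t m := \tr (Sig m).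

Let t_ge0 m : 0 <= t m.
Proof. by apply: psd_mxtrace_ge0; exact: psd_Sigma. Qed.

Let tS m : t m.+1 <= t m.
Proof.
have := mxtrace_SigmaS_le alpha beta e_sym X sw0 m.
by rewrite sc1 mul1r.
Qed.

Let t_homo : {homo t : m m' / (m <= m')%N >-> m' <= m}.
Proof. by apply/nonincreasing_seqP. Qed.

Let t_cvg : cvgn t.
Proof.
apply: nonincreasing_is_cvgn => //.
by exists 0 => _ [m _ <-].
Qed.

Lemma FSP_cvg0 : limn t = 0 -> FSP sigma C e X sw2 @ \oo --> 0%E.
Proof.
move=> t0; rewrite -cvg_shiftS/=.
rewrite (_ : (fun L => FSP sigma C e X sw2 L.+1) =
    EFin \o (fun L => C%:R * t L / frob2 X)); last first.
  by apply/funext => L; rewrite FSPE.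
apply: cvg_EFin; first exact: nearW.
rewrite (_ : fine \o _ = (fun L => C%:R * t L / frob2 X))//.
suff : (fun L => C%:R * t L / frob2 X) @ \oo --> C%:R * 0 / frob2 X.
  by rewrite mulr0 mul0r.
rewrite -t0; apply: cvgM; last exact: cvg_cst.
by apply: cvgM; first exact: cvg_cst.
Qed.

Lemma GEV_cvg0 : 0 < limn t -> GEV sigma C e X sw2 @ \oo --> 0%E.
Proof.
set l := limn t => l0.
(* The harmonic term keeps [q m] positive even when the trace stops decreasing, so that the cut-off
   below is positive. *)
pose q m := n.+1%:R * (t m - t m.+1) + harmonic m.
have q0 m : 0 < q m.
  by rewrite ltr_wpDl ?mulr_ge0 ?subr_ge0 ?tS// harmonic_gt0.
have qcvg : q @ \oo --> (0 : R).
  suff : q @ \oo --> n.+1%:R * (l - l) + 0 by rewrite subrr mulr0 addr0.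
  apply: cvgD; last exact: cvg_harmonic.
  apply: cvgM; first exact: cvg_cst.
  apply: cvgB => //; rewrite (_ : (fun m => t m.+1) = [sequence t m.+1]_m)//.
  by rewrite cvg_shiftS.
pose K := 4 * normal_peak 1 * n.+1%:R / Num.sqrt l.
(* With the fourth root, [q m / s m ^+ 2 = s m ^+ 2], so both terms of the ratio bound tend to 0. *)
pose s m := Num.sqrt (Num.sqrt (q m)).
have s0 m : 0 < s m by rewrite !sqrtr_gt0.
have scvg : s @ \oo --> (0 : R).
  suff : s @ \oo --> Num.sqrt (Num.sqrt (0 : R)) by rewrite !sqrtr0.
  apply: continuous_cvg; first exact: sqrt_continuous.
  by apply: continuous_cvg; first exact: sqrt_continuous.
pose g m := gaussE (n * C) (fun z =>
  Dir e (covfactor (Sig m.+1) *m zmat n C z) /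
  frob2 (covfactor (Sig m.+1) *m zmat n C z)).
have g_le m : g m <= C%:R * s m ^+ 2 + K * s m.
  have pS := psd_Sigma alpha beta e_sym X sw0 m.+1.
  have lt : l <= \tr (Sig m.+1) by exact: nonincreasing_cvgn_ge.
  apply: (le_trans (gaussE_Dir_ratio_le e_sym C0 pS l0 lt (s0 m))).
  rewrite lerD2r -mulrA ler_wpM2l// ler_pdivrMr ?exprn_gt0//.
  have s2 : s m ^+ 2 = Num.sqrt (q m) by rewrite sqr_sqrtr ?sqrtr_ge0.
  rewrite s2 -expr2 sqr_sqrtr ?(ltW (q0 m))//.
  apply: (le_trans (mxtrace_Lhat_Sigma_le e_sym X sw0 m sc1)).
  by rewrite lerDl ltW// harmonic_gt0.
have g_ge0 m : 0 <= g m.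
  apply: gaussE_ge0; first exact: admissible_Dir_ratio.
  by move=> z; exact: Dir_ratio_ge0.
have gcvg : g @ \oo --> (0 : R).
  apply: (@squeeze_cvgr _ _ _ _ (cst 0) (fun m => C%:R * s m ^+ 2 + K * s m)).
  - by near=> m; rewrite g_ge0 g_le.
  - exact: cvg_cst.
  - suff : (fun m => C%:R * s m ^+ 2 + K * s m) @ \oo --> C%:R * (0 * 0) + K * 0.
      by rewrite !mulr0 addr0.
    apply: cvgD; (apply: cvgM; first exact: cvg_cst) => //.
    by rewrite (_ : (fun m => s m ^+ 2) = (fun m => s m * s m)) //; apply: cvgM.
(* One shift passes from layer [L] to [Sig L.-1], the other is due to the energy bound, which
   concerns [Sig m.+1]. *)
rewrite -(cvg_shiftn 2)/=.
rewrite (_ : (fun L => GEV sigma C e X sw2 (L + 2)) = EFin \o g); last first.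
  by apply/funext => L; rewrite GEVE addn2.
by apply: cvg_EFin; first exact: nearW.
Unshelve. all: by end_near. Qed.

Lemma GEV_or_FSP_cvg0 :
  (GEV sigma C e X sw2 @ \oo --> 0%E) \/ (FSP sigma C e X sw2 @ \oo --> 0%E).
Proof.
have : 0 <= limn t by apply: limr_ge => //; exact: nearW.
rewrite le_eqVlt => /predU1P[/esym t0|t0]; first by right; exact: FSP_cvg0.
by left; exact: GEV_cvg0.
Qed.

End metrics.

Unset Implicit Arguments.

Theorem mainTheorem2 (R : realType) (alpha beta : R)
  (ha : 0 <= alpha) (hb : 0 <= beta) (hab : (alpha != 0) || (beta != 0))
  (n d0 C : nat) (e : rel 'I_n)
  (e_sym : forall i j, e i j = e j i) (e_irr : forall i, e i i = false)
  (X : 'M[R]_(n, d0)) (hX : X != 0) (hC : (1 <= C)%N)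
  (sw2 : R) (hsw : 0 < sw2) :
  (sw2 = 2 / (alpha ^+ 2 + beta ^+ 2) ->
     (GEV (abrelu alpha beta) C e X sw2 @ \oo --> 0%E) \/
     (FSP (abrelu alpha beta) C e X sw2 @ \oo --> 0%E)) /\
  (sw2 < 2 / (alpha ^+ 2 + beta ^+ 2) ->
     forall L : nat, (1 <= L)%N ->
       (FSP (abrelu alpha beta) C e X sw2 L
        <= ((2 * C%:R) / ((alpha ^+ 2 + beta ^+ 2) * d0%:R)
            * (sw2 * (alpha ^+ 2 + beta ^+ 2) / 2) ^+ L)%:E)%E).
Proof.
have ab0 : 0 < alpha ^+ 2 + beta ^+ 2.
  have [a0|a0] := eqVneq alpha 0.
    by rewrite a0 eqxx/= in hab; rewrite ltr_wpDl ?sqr_ge0// exprn_even_gt0.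
  by rewrite ltr_pwDl ?sqr_ge0// exprn_even_gt0.
split=> [sE|_ L L1].
  apply: GEV_or_FSP_cvg0 => //.
  by rewrite sE; field; rewrite gt_eqF.
have fX0 := frob2_gt0 hX.
(* A matrix without columns has no nonzero entry, so [X != 0] forces [d0 > 0]. *)
have d00 : (0 : R) < d0%:R.
  rewrite ltr0n; case: (d0) X hX {fX0} => // X' /matrix0Pn[i [[]]].
  by [].
rewrite FSPE// lee_fin ler_pdivrMr//.
apply: (le_trans (ler_wpM2l (ler0n _ C)
  (mxtrace_Sigma_le alpha beta e_sym X hsw L.-1))).
(* The trace bound has exponent [L - 1] and prefactor [sw2 / d0]; trading [sw2] for one more factor
   [sw2 * (alpha^2 + beta^2) / 2] leaves the constant [2 / ((alpha^2 + beta^2) d0)]. *)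
case: L L1 => // L _; rewrite [L.+1.-1]/= [_ ^+ L.+1]exprS.
rewrite (mulrA sw2); set P := _ ^+ L; set r := _ + beta ^+ 2 in ab0 *.
rewrite le_eqVlt; apply/orP; left; apply/eqP.
by field; rewrite !gt_eqF.
Qed.
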